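(* Let $n\ge0$ be an integer, let $s_1,s_2,s_3$ be integers with $s_i\ge1$ for $i=1,2,3$ and $s_1\le s_2$, $s_1\le s_3$, and put $\hat s=\max\{s_2,s_3\}$. Let $$Q^{+}(x,y)=\sum_{s=s_1}^{s_2}Q_{n,s}^{+}(x)y^{s},\qquad Q^{-}(x,y)=\sum_{s=s_1}^{s_3}Q_{n,s}^{-}(x)y^{s},$$ where the $Q^{\pm}_{n,s}(x)$ are trigonometric polynomials of degree $n$ with free coefficients, and let $$\widetilde M(h)=\int_{\Gamma_h^+}Q^{+}(x,y)\,\mathrm{d}x+\int_{\Gamma_h^-}Q^{-}(x,y)\,\mathrm{d}x,\qquad h\in(0,2).$$ When $\widetilde M(h)\not\equiv0$, there exists $0<\varepsilon_0\ll1$ such that on the interval $h\in(0,\varepsilon_0)$ the function $\widetilde M(h)$ has at most $\hat s-s_1$ zeros (counting multiplicity) if $n=0$, or at most $n$ zeros (counting multiplicity) if $n>0$ and $\hat s=s_1$, or at most $2(n+\hat s-s_1)-1$ zeros (counting multiplicity) if $n>0$ and $\hat s>s_1$. This upper bound is sharp.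
   Context: $\widetilde M(h)$ is the first order Melnikov function, on the oscillatory region, of the piecewise smooth perturbed pendulum system $\dot x=y$, $\dot y=-\sin(x)+\varepsilon Q^{\pm}(x,y)$ for $\pm y>0$, with $|\varepsilon|\ll1$. The unperturbed system $\dot x=y$, $\dot y=-\sin(x)$ has Hamiltonian $H(x,y)=\frac12y^2+1-\cos(x)$ on the cylinder $[-\pi,\pi]\times\mathbb{R}$. For $h\in(0,2)$, $\Gamma_h$ is the periodic orbit defined by $H(x,y)=h$, which surrounds the center at the origin and is oriented by the flow, and $\Gamma_h^{\pm}=\Gamma_h\cap\{\pm y>0\}$ with the induced orientation. Here a trigonometric polynomial of degree $n$ with free coefficients means an expression $\sum_{i=0}^n a_{i}\cos^i(x)+\sin(x)\sum_{i=0}^{n-1}\tilde a_{i}\cos^i(x)$ whose real coefficients $a_i,\tilde a_i$ are free parameters (so the actual degree is at most $n$). *)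

(* Defs.v *)
From Stdlib Require Import Reals Lra Lia List.
From Coquelicot Require Import Coquelicot.
Import ListNotations.
Open Scope R_scope.

(* The second sum runs over 0 <= i <= n - 1, hence is empty for n = 0. *)
Definition trig_poly (n : nat) (a b : nat -> R) (x : R) : R :=
  sum_n (fun i => a i * cos x ^ i) n +
  sin x * match n with
          | O => 0
          | S m => sum_n (fun i => b i * cos x ^ i) m
          end.

(* Row s of the coefficient families a, b gives the trigonometric polynomial
   multiplying y ^ s. *)
Definition pert (n s s' : nat) (a b : nat -> nat -> R) (x y : R) : R :=
  sum_n_m (fun k => trig_poly n (a k) (b k) x * y ^ k) s s'.

Definition ham (x y : R) : R := y ^ 2 / 2 + 1 - cos x.

(* Integral of F dx along the oriented curve t |-> (gx t, gy t), t : a -> b. *)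
Definition line_int_dx (F : R -> R -> R) (gx gy : R -> R) (a b : R) : R :=
  RInt (fun t => F (gx t) (gy t) * Derive gx t) a b.

(* For 0 < h < 2 the level curve ham = h meets y = 0 at x = xmax h and
   x = - xmax h. *)
Definition xmax (h : R) : R := acos (1 - h).
Definition yabs (h x : R) : R := sqrt (2 * (h - 1 + cos x)).

(* Both arcs are traversed for t from - xmax h to xmax h. The flow has x' = y,
   so x increases along the upper arc and decreases along the lower one. *)
Definition upper_x (t : R) : R := t.
Definition upper_y (h t : R) : R := yabs h t.
Definition lower_x (t : R) : R := - t.
Definition lower_y (h t : R) : R := - yabs h t.

Definition melnikov (Qp Qm : R -> R -> R) (h : R) : R :=
  line_int_dx Qp upper_x (upper_y h) (- xmax h) (xmax h) +
  line_int_dx Qm lower_x (lower_y h) (- xmax h) (xmax h).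

Definition zero_mult (f : R -> R) (z : R) (m : nat) : Prop :=
  (forall j, (j < m)%nat -> is_derive_n f j z 0) /\
  (exists c, c <> 0 /\ is_derive_n f m z c).

(* f has finitely many zeros in (a, b), all of finite multiplicity, and their
   multiplicities add up to N; l lists the zeros with their multiplicities. *)
Definition zero_count (f : R -> R) (a b : R) (N : nat) : Prop :=
  exists l : list (R * nat),
    NoDup (map fst l) /\
    (forall z, In z (map fst l) <-> a < z < b /\ f z = 0) /\
    (forall z m, In (z, m) l -> zero_mult f z m) /\
    list_sum (map snd l) = N.

Definition nonzero_on (f : R -> R) (a b : R) : Prop :=
  exists h, a < h < b /\ f h <> 0.

(* The two arcs trace the parts of the level curve in y > 0 and y < 0, with the
   orientation of the flow. *)

Lemma cos_gt_xmax (h x : R) : 0 < h < 2 -> - PI <= x <= PI ->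
  (0 < h - 1 + cos x <-> - xmax h < x < xmax h).
Proof.
intros Hh Hx; unfold xmax.
destruct (acos_bound (1 - h)) as [X0 X1].
assert (CX : cos (acos (1 - h)) = 1 - h) by (apply cos_acos; lra).
assert (Ca : cos (Rabs x) = cos x).
{ unfold Rabs; destruct (Rcase_abs x); [apply cos_neg | reflexivity]. }
assert (Ra : 0 <= Rabs x <= PI).
{ split; [apply Rabs_pos | apply Rabs_le; lra]. }
split; intros H0.
- assert (Hlt : Rabs x < acos (1 - h)) by (apply cos_decreasing_0; lra).
  apply Rabs_def2 in Hlt; lra.
- assert (Hlt : Rabs x < acos (1 - h)) by (apply Rabs_def1; lra).
  assert (cos (acos (1 - h)) < cos (Rabs x)) by (apply cos_decreasing_1; lra).
  lra.
Qed.

Lemma upper_arcP (h x y : R) : 0 < h < 2 ->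
  (- PI <= x <= PI /\ ham x y = h /\ 0 < y <->
   exists t, - xmax h < t < xmax h /\ x = upper_x t /\ y = upper_y h t).
Proof.
intros Hh; unfold ham, upper_x, upper_y, yabs; split.
- intros (Hx & HH & Hy); exists x; split; [|split]; auto.
  + apply cos_gt_xmax; auto; nra.
  + symmetry; apply sqrt_lem_1; nra.
- intros (t & Ht & -> & ->).
  assert (Hx : - PI <= t <= PI).
  { unfold xmax in Ht; destruct (acos_bound (1 - h)); lra. }
  assert (Hc : 0 < h - 1 + cos t) by (apply cos_gt_xmax; auto).
  split; [|split]; auto.
  + rewrite pow2_sqrt; lra.
  + apply sqrt_lt_R0; lra.
Qed.

Lemma lower_arcP (h x y : R) : 0 < h < 2 ->
  (- PI <= x <= PI /\ ham x y = h /\ y < 0 <->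
   exists t, - xmax h < t < xmax h /\ x = lower_x t /\ y = lower_y h t).
Proof.
intros Hh.
assert (HN : ham (- x) (- y) = ham x y) by (unfold ham; rewrite cos_neg; nra).
pose proof (upper_arcP h (- x) (- y) Hh) as E; rewrite HN in E.
unfold upper_x, upper_y in E; unfold lower_x, lower_y; split.
- intros (Hx & HH & Hy).
  destruct (proj1 E) as (t & Ht & E1 & E2); [lra|].
  exists t; lra.
- intros (t & Ht & E1 & E2).
  assert (- PI <= - x <= PI /\ ham x y = h /\ 0 < - y); [|lra].
  apply (proj2 E); exists t; lra.
Qed.

Lemma arcs_oriented (h t : R) : 0 < h < 2 -> - xmax h < t < xmax h ->
  exists c, 0 < c /\
    is_derive upper_x t (c * upper_y h t) /\
    is_derive (upper_y h) t (c * - sin (upper_x t)) /\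
    is_derive lower_x t (c * lower_y h t) /\
    is_derive (lower_y h) t (c * - sin (lower_x t)).
Proof.
intros Hh Ht.
assert (Hx : - PI <= t <= PI).
{ unfold xmax in Ht; destruct (acos_bound (1 - h)); lra. }
assert (Hc : 0 < h - 1 + cos t) by (apply cos_gt_xmax; auto).
assert (Hs : 0 < yabs h t) by (unfold yabs; apply sqrt_lt_R0; lra).
exists (/ yabs h t); split; [now apply Rinv_0_lt_compat|].
unfold upper_x, upper_y, lower_x, lower_y.
split; [|split; [|split]].
- replace (/ yabs h t * yabs h t) with 1 by (field; lra).
  auto_derive; auto.
- unfold yabs in *; auto_derive; [lra|field; lra].
- replace (/ yabs h t * - yabs h t) with (- 1) by (field; lra).
  auto_derive; auto; ring.
- rewrite sin_neg; unfold yabs in *; auto_derive; [lra|field; lra].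
Qed.

(* Main.v *)
Require Import Defs.
From Stdlib Require Import Arith Reals Lra Lia List Sorting.Sorted Permutation Classical.
From Coquelicot Require Import Coquelicot.
Import ListNotations.
Open Scope R_scope.

(** Why the theorem holds. By symmetry in x the sine parts of the coefficients
    integrate to zero, and the two arcs contribute the same integrals up to sign.
    Hence the functions M form exactly the span of the integrals of
    cos x ^ i * y ^ s over the upper arc, for i <= n and s1 <= s <= shat
    (melnikov_expansion, level_int_in_melnikov_space).

    Put u = 1 - cos x. The substitution sin (x / 2) = sqrt (h / 2) * sin th turns
    the integral of u ^ i * y ^ s into h ^ ((s + 1) / 2) times a power series
    in h that converges for h < 2 (level_int_series). So the integrals fall into
    two classes by the parity of s - s1, and a class with sg = 0 or 1 carries the
    common factor h ^ ((s1 + sg + 1) / 2). In a class, with s = s1 + sg + 2 j and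
    0 <= j <= K, the m-th coefficient is a fixed nonzero weight times a rational
    function of m with poles at half-integers (moment_seq_series). For n > 0 these
    rational functions span all numerators of degree at most n + 2 K over one
    denominator (moment_seq_rational, rational_in_span); for n = 0 they are
    K + 1 functions. In both cases the span has a basis whose r-th series starts
    with h ^ r (basis_in_moments, moments_in_basis). Counting gives in total
    bound + 1 functions h ^ mu * G h, with pairwise distinct exponents mu and with
    G smooth near 0 and nonzero at 0 (class_dim_total, class_fun_factor), that
    have the same span as the functions M on (0, 2) (level_span).

    Such a system is a Chebyshev system near 0. Dividing by one of its functions
    and differentiating leaves a system of the same kind with one function less,
    so Rolle's theorem with multiplicities bounds the zeros of a nonzero
    combination by bound, on an interval that does not depend on the coefficients
    (power_system_bound). Conversely, linear algebra gives a nonzero combination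
    that vanishes at any bound prescribed points; by the bound these zeros are
    simple and are the only ones (power_system_zeros). *)

Ltac real_eq := match goal with |- @eq _ ?a ?b => refine (_ : @eq R a b) end.

(** * Smooth functions on an open interval *)

(** The recursion on the total operator Derive gives proofs by induction on k for
    products and inverses. *)
Fixpoint Ck (a b : R) (k : nat) (f : R -> R) : Prop :=
  match k with
  | O => True
  | S k => (forall x, a < x < b -> ex_derive f x) /\ Ck a b k (Derive f)
  end.

Definition smooth (a b : R) (f : R -> R) : Prop := forall k, Ck a b k f.

Lemma locally_open_interval (a b x : R) (P : R -> Prop) :
  a < x < b -> (forall y, a < y < b -> P y) -> locally x P.
Proof.
intros Hx HP.
assert (He : 0 < Rmin (x - a) (b - x)) by (apply Rmin_pos; lra).
exists (mkposreal _ He); intros y Hy; apply HP.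
apply Rabs_lt_between' in Hy; simpl in Hy.
pose proof (Rmin_l (x - a) (b - x)); pose proof (Rmin_r (x - a) (b - x)); lra.
Qed.

Lemma Derive_ext_interval (a b : R) (f g : R -> R) :
  (forall x, a < x < b -> f x = g x) ->
  forall x, a < x < b -> Derive f x = Derive g x.
Proof.
intros E x Hx; apply Derive_ext_loc, (locally_open_interval a b); auto.
Qed.

Lemma Ck_ext (a b : R) k : forall f g,
  (forall x, a < x < b -> f x = g x) -> Ck a b k f -> Ck a b k g.
Proof.
induction k as [|k IH]; intros f g E; simpl; auto; intros [D C]; split.
- intros x Hx; apply ex_derive_ext_loc with f; auto.
  apply (locally_open_interval a b); auto.
- apply IH with (Derive f); auto; apply Derive_ext_interval; auto.
Qed.

Lemma Ck_step (a b : R) k (f df : R -> R) :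
  (forall x, a < x < b -> is_derive f x (df x)) -> Ck a b k df -> Ck a b (S k) f.
Proof.
intros D C; split.
- intros x Hx; exists (df x); auto.
- apply Ck_ext with df; auto.
  intros x Hx; symmetry; apply is_derive_unique; auto.
Qed.

Lemma Ck_pred (a b : R) k : forall f, Ck a b (S k) f -> Ck a b k f.
Proof.
induction k as [|k IH]; intros f; simpl; auto.
intros [D C]; split; auto; apply IH; auto.
Qed.

Lemma Ck_sub (a b a' b' : R) k : a' <= a -> b <= b' ->
  forall f, Ck a' b' k f -> Ck a b k f.
Proof.
intros Ha Hb; induction k as [|k IH]; intros f; simpl; auto.
intros [D C]; split; auto; intros x Hx; apply D; lra.
Qed.

Lemma Ck_is_derive (a b : R) k f x :
  Ck a b (S k) f -> a < x < b -> is_derive f x (Derive f x).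
Proof. intros [D _] Hx; apply Derive_correct, D, Hx. Qed.

Lemma Ck_const (a b : R) k : forall c, Ck a b k (fun _ => c).
Proof.
induction k as [|k IH]; intros c; [exact I|].
apply Ck_step with (fun _ => 0); auto.
intros x _; apply (is_derive_const c x).
Qed.

Lemma Ck_id (a b : R) k : Ck a b k (fun x => x).
Proof.
destruct k as [|k]; [exact I|].
apply Ck_step with (fun _ => 1); [intros x _; apply (is_derive_id x)|apply Ck_const].
Qed.

Lemma Ck_plus (a b : R) k : forall f g,
  Ck a b k f -> Ck a b k g -> Ck a b k (fun x => f x + g x).
Proof.
induction k as [|k IH]; intros f g F G; [exact I|].
apply Ck_step with (fun x => Derive f x + Derive g x).
- intros x Hx; apply (is_derive_plus (V := R_NormedModule) f g x);
    apply Ck_is_derive with a b k; auto.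
- apply IH; [apply F|apply G].
Qed.

Lemma Ck_mult (a b : R) k : forall f g,
  Ck a b k f -> Ck a b k g -> Ck a b k (fun x => f x * g x).
Proof.
induction k as [|k IH]; intros f g F G; [exact I|].
apply Ck_step with (fun x => Derive f x * g x + f x * Derive g x).
- intros x Hx; apply (is_derive_mult f g x).
  + apply Ck_is_derive with a b k; auto.
  + apply Ck_is_derive with a b k; auto.
  + intros; apply Rmult_comm.
- apply Ck_plus; apply IH; try (apply Ck_pred; assumption); [apply F|apply G].
Qed.

Lemma Ck_inv (a b : R) k : forall f,
  (forall x, a < x < b -> f x <> 0) -> Ck a b k f -> Ck a b k (fun x => / f x).
Proof.
induction k as [|k IH]; intros f N F; [exact I|].
apply Ck_step with (fun x => (-1 * Derive f x) * (/ f x * / f x)).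
- intros x Hx.
  replace (-1 * Derive f x * (/ f x * / f x)) with (- Derive f x / f x ^ 2)
    by (field; auto).
  apply is_derive_inv; auto; apply Ck_is_derive with a b k; auto.
- pose proof (IH f N (Ck_pred _ _ _ _ F)).
  repeat apply Ck_mult; auto; [apply Ck_const|apply F].
Qed.

Lemma Ck_sum (a b : R) k (f : nat -> R -> R) n :
  (forall i, (i <= n)%nat -> Ck a b k (f i)) ->
  Ck a b k (fun x => sum_n (fun i => f i x) n).
Proof.
induction n as [|n IH]; intros F.
- apply Ck_ext with (f O); auto; intros x _; now rewrite sum_O.
- apply Ck_ext with (fun x => sum_n (fun i => f i x) n + f (S n) x).
  + intros x _; now rewrite sum_Sn.
  + apply Ck_plus; auto.
Qed.

Lemma Rpower_gt_0 (x mu : R) : 0 < Rpower x mu.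
Proof. apply exp_pos. Qed.

Lemma Rpower_is_derive (mu x : R) : 0 < x ->
  is_derive (fun x => Rpower x mu) x (mu * Rpower x (mu - 1)).
Proof. intros Hx; apply is_derive_Reals, derivable_pt_lim_power; auto. Qed.

Lemma Ck_Rpower (a b : R) k : 0 <= a -> forall mu, Ck a b k (fun x => Rpower x mu).
Proof.
intros Ha; induction k as [|k IH]; intros mu; [exact I|].
apply Ck_step with (fun x => mu * Rpower x (mu - 1)).
- intros x Hx; apply Rpower_is_derive; lra.
- apply Ck_mult; [apply Ck_const|apply IH].
Qed.

Lemma Ck_PSeries (r : R) k : forall a, Rbar_le r (CV_radius a) ->
  Ck (- r) r k (PSeries a).
Proof.
induction k as [|k IH]; intros a Ha; [exact I|].
apply Ck_step with (PSeries (PS_derive a)).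
- intros x Hx; apply is_derive_PSeries.
  apply Rbar_lt_le_trans with r; auto; apply Rabs_def1; lra.
- apply IH; rewrite CV_radius_derive; auto.
Qed.

Lemma Derive_n_S (f : R -> R) j x : Derive_n f (S j) x = Derive_n (Derive f) j x.
Proof. rewrite (Derive_n_comp f j 1); f_equal; lia. Qed.

Lemma Ck_ex_derive_n (a b : R) k : forall f, Ck a b k f ->
  forall x, a < x < b -> ex_derive_n f k x.
Proof.
induction k as [|k IH]; intros f F x Hx; [exact I|].
destruct F as [D C]; destruct k as [|k]; [apply D; auto|].
specialize (IH _ C x Hx); simpl in IH |- *.
eapply ex_derive_ext; [|exact IH].
intros t; symmetry; apply (Derive_n_S f k t).
Qed.

Lemma smooth_continuous (a b : R) f x : smooth a b f -> a < x < b -> continuity_pt f x.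
Proof.
intros F Hx; apply continuity_pt_filterlim, (ex_derive_continuous f x).
apply (F 1%nat); auto.
Qed.

(** * Rolle's theorem counted with multiplicity *)

Definition vanish (f : R -> R) (z : R) (m : nat) : Prop :=
  forall j, (j < m)%nat -> Derive_n f j z = 0.

Lemma vanish_S (f : R -> R) z m :
  vanish f z (S m) <-> f z = 0 /\ vanish (Derive f) z m.
Proof.
split.
- intros V; split; [apply (V O); lia|].
  intros j Hj; rewrite <- Derive_n_S; apply V; lia.
- intros [V0 V] [|j] Hj; auto; rewrite Derive_n_S; apply V; lia.
Qed.

Lemma vanish_ext (a b : R) f g z m : a < z < b ->
  (forall x, a < x < b -> f x = g x) -> vanish f z m -> vanish g z m.
Proof.
intros Hz E V j Hj; rewrite <- (V j Hj); symmetry; apply Derive_n_ext_loc.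
apply (locally_open_interval a b); auto.
Qed.

Lemma vanish_plus (a b : R) z m : a < z < b -> forall f g,
  Ck a b m f -> Ck a b m g -> vanish f z m -> vanish g z m ->
  vanish (fun x => f x + g x) z m.
Proof.
intros Hz; induction m as [|m IH]; intros f g F G Vf Vg; [intros j Hj; lia|].
apply vanish_S in Vf; apply vanish_S in Vg; apply vanish_S; split; [lra|].
apply vanish_ext with a b (fun x => Derive f x + Derive g x); auto.
- intros x Hx; symmetry; apply is_derive_unique.
  apply (is_derive_plus (V := R_NormedModule) f g x); apply Ck_is_derive with a b m; auto.
- apply IH; try (apply F || apply G); tauto.
Qed.

(** Multiplying by a smooth factor does not lower the order of a zero: by the
    product rule the derivative is a sum of two terms of the order one less. *)
Lemma vanish_mult (a b : R) z m : a < z < b -> forall u f,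
  Ck a b m u -> Ck a b m f -> vanish f z m -> vanish (fun x => u x * f x) z m.
Proof.
intros Hz; induction m as [|m IH]; intros u f U F V; [intros j Hj; lia|].
assert (V' : vanish f z m) by (intros j Hj; apply V; lia).
apply vanish_S in V; destruct V as [V0 V]; apply vanish_S; split.
- rewrite V0; ring.
- apply vanish_ext with a b (fun x => Derive u x * f x + u x * Derive f x); auto.
  + intros x Hx; symmetry; apply is_derive_unique.
    apply (is_derive_mult u f x); try (apply Ck_is_derive with a b m; auto).
    intros; apply Rmult_comm.
  + pose proof (Ck_pred _ _ _ _ U); pose proof (Ck_pred _ _ _ _ F).
    destruct U as [DU U]; destruct F as [DF F].
    apply vanish_plus with a b; auto using Ck_mult.
Qed.

Definition fst_lt (p q : R * nat) : Prop := fst p < fst q.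

(** The order makes the points distinct, and multiplicities are positive, so
    that the sum of the second components is a lower bound for the number of
    zeros counted with multiplicity. *)
Definition zero_list (f : R -> R) (a b : R) (l : list (R * nat)) : Prop :=
  StronglySorted fst_lt l /\
  forall z m, In (z, m) l -> a < z < b /\ (1 <= m)%nat /\ vanish f z m.

Lemma zero_list_tail f a b p l : zero_list f a b (p :: l) -> zero_list f a b l.
Proof.
intros [Hs Z]; split; [apply StronglySorted_inv in Hs; tauto|].
intros z m H; apply Z; right; auto.
Qed.

Lemma zero_list_cons f a b z m l : a < z < b -> (1 <= m)%nat -> vanish f z m ->
  (forall p, In p l -> z < fst p) -> zero_list f a b l ->
  zero_list f a b ((z, m) :: l).
Proof.
intros Hz Hm V L [O Z]; split.
- constructor; auto; apply Forall_forall; intros p Hp; apply L; auto.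
- intros z' m' [E|H]; [injection E as <- <-; auto|apply Z; auto].
Qed.

Lemma Rolle_interval (f : R -> R) a b x y : smooth a b f -> a < x -> x < y -> y < b ->
  f x = 0 -> f y = 0 -> exists c, x < c < y /\ Derive f c = 0.
Proof.
intros F Hx Hxy Hy fx fy.
assert (pr : forall c, x < c < y -> derivable_pt f c).
{ intros c Hc; apply ex_derive_Reals_0, (F 1%nat); lra. }
destruct (Rolle f x y pr) as (c & P & E); try lra.
- intros c Hc; apply smooth_continuous with a b; auto; lra.
- exists c; split; auto; rewrite <- E.
  now rewrite (Derive_Reals f c).
Qed.

(** Between consecutive zeros the derivative gains a zero, and at each zero it
    loses one from the multiplicity: the total drops by exactly one. *)
Lemma Rolle_mult (f : R -> R) a b : smooth a b f -> forall l z m,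
  zero_list f a b ((z, m) :: l) ->
  exists l', zero_list (Derive f) a b l' /\
    S (list_sum (map snd l')) = list_sum (map snd ((z, m) :: l)) /\
    forall p, In p l' -> z <= fst p.
Proof.
intros F l; induction l as [|[z' m'] l IH]; intros z m Zl.
- destruct Zl as [_ Z]; destruct (Z z m) as (Hz & Hm & V); [now left|].
  destruct m as [|[|m]]; [lia| |].
  + exists []; split; [split; [constructor|intros ? ? []]|].
    split; [reflexivity|intros p []].
  + exists [(z, S m)]; apply vanish_S in V; split; [|split].
    * apply zero_list_cons; try lia; try tauto; [intros p []|].
      split; [constructor|intros ? ? []].
    * simpl; lia.
    * intros p [<-|[]]; simpl; lra.
- destruct (IH z' m' (zero_list_tail _ _ _ _ _ Zl)) as (l' & Zl' & S' & L').
  destruct Zl as [Hs Z]; destruct (Z z m) as (Hz & Hm & V); [now left|].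
  destruct (Z z' m') as (Hz' & Hm' & V'); [now right; left|].
  assert (Hzz : z < z').
  { apply StronglySorted_inv in Hs; destruct Hs as [_ Hs]; inversion Hs; auto. }
  destruct (Rolle_interval f a b z z') as (c & Hc & Dc); try tauto.
  { apply (V O); lia. } { apply (V' O); lia. }
  assert (Zc : zero_list (Derive f) a b ((c, 1%nat) :: l')).
  { apply zero_list_cons; auto; try lra.
    - intros [|j] Hj; [exact Dc|lia].
    - intros p Hp; apply L' in Hp; lra. }
  destruct m as [|[|m]]; [lia| |].
  + exists ((c, 1%nat) :: l'); split; auto; split; [simpl in *; lia|].
    intros p [<-|Hp]; simpl; [lra|apply L' in Hp; lra].
  + exists ((z, S m) :: (c, 1%nat) :: l'); apply vanish_S in V; split; [|split].
    * apply zero_list_cons; try lia; try tauto.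
      intros p [<-|Hp]; simpl; [lra|apply L' in Hp; lra].
    * simpl in *; lia.
    * intros p [<-|[<-|Hp]]; simpl; [lra|lra|apply L' in Hp; lra].
Qed.


(** * Zeros near 0 of combinations of powers *)

Lemma zero_list_nil_of_nonzero f a b l :
  (forall x, a < x < b -> f x <> 0) -> zero_list f a b l -> l = [].
Proof.
intros N [_ Z]; destruct l as [|[z m] l]; auto; exfalso.
destruct (Z z m) as (Hz & Hm & V); [now left|].
apply (N z Hz), (V O); lia.
Qed.

Lemma nonzero_near_0 (G : R -> R) del : 0 < del -> G 0 <> 0 -> smooth (- del) del G ->
  exists eps, 0 < eps <= del /\ forall x, - eps < x < eps -> G x <> 0.
Proof.
intros Hdel N F.
destruct (continuous_neq_0 G 0) as [e He]; auto.
{ apply smooth_continuous with (- del) del; auto; lra. }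
exists (Rmin e del); pose proof (Rmin_l e del); pose proof (Rmin_r e del).
split; [split; auto; apply Rmin_pos; auto; apply cond_pos|].
intros x Hx; rewrite <- (Rplus_0_l x); apply He, Rabs_def1; lra.
Qed.

(** Division by the last function followed by differentiation removes that
    function and keeps the form h ^ mu * G h with G 0 <> 0 of the others, because
    the exponents are distinct; by Rolle it costs one zero. The interval depends
    on the functions only, so eps serves all coefficients c. *)
Lemma power_system_bound d : forall (mu : nat -> R) (G : nat -> R -> R) (del : R),
  0 < del ->
  (forall i j, (i < j <= d)%nat -> mu i <> mu j) ->
  (forall i, (i <= d)%nat -> G i 0 <> 0 /\ smooth (- del) del (G i)) ->
  exists eps, 0 < eps <= del /\
    forall c : nat -> R, (exists i, (i <= d)%nat /\ c i <> 0) ->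
    forall l, zero_list (fun h => sum_n (fun i => c i * (Rpower h (mu i) * G i h)) d) 0 eps l ->
    (list_sum (map snd l) <= d)%nat.
Proof.
induction d as [|d IH]; intros mu G del Hdel Hmu HG.
- destruct (HG O (le_n _)) as [N Sm].
  destruct (nonzero_near_0 _ _ Hdel N Sm) as (e & He & Ne).
  exists e; split; auto; intros c (i & Hi & Hc) l Zl.
  replace i with O in Hc by lia.
  apply zero_list_nil_of_nonzero in Zl; [rewrite Zl; simpl; lia|].
  intros x Hx; simpl; rewrite sum_O; pose proof (Rpower_gt_0 x (mu O)).
  apply Rmult_integral_contrapositive_currified; auto.
  apply Rmult_integral_contrapositive_currified; [lra|apply Ne; lra].
- destruct (HG (S d) (le_n _)) as [N Sm].
  destruct (nonzero_near_0 _ _ Hdel N Sm) as (e & He & Ne).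
  set (Q := fun i x => G i x * / G (S d) x).
  (* the derivative of x ^ nu * Q x is x ^ (nu - 1) * (nu * Q x + x * Q' x) *)
  set (G' := fun i x => (mu i - mu (S d)) * Q i x + x * Derive (Q i) x).
  assert (SQ : forall i, (i <= S d)%nat -> smooth (- e) e (Q i)).
  { intros i Hi k; apply Ck_mult.
    - apply Ck_sub with (- del) del; try lra; apply HG; auto.
    - apply Ck_inv; auto; apply Ck_sub with (- del) del; try lra; apply Sm. }
  destruct (IH (fun i => mu i - mu (S d) - 1) G' e) as (eps & Heps & B); try lra.
  { intros i j Hij E; apply (Hmu i j); [lia|lra]. }
  { intros i Hi; split.
    - unfold G'; rewrite Rmult_0_l, Rplus_0_r.
      apply Rmult_integral_contrapositive_currified.
      + intros E; apply (Hmu i (S d)); [lia|lra].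
      + apply Rmult_integral_contrapositive_currified; [apply HG; lia|].
        apply Rinv_neq_0_compat; auto.
    - intros k; apply Ck_plus; apply Ck_mult; try apply Ck_const; try apply Ck_id.
      + apply SQ; lia.
      + apply (SQ i ltac:(lia) (S k)). }
  exists eps; split; [lra|]; intros c Hc l Zl.
  set (f := fun h => sum_n (fun i => c i * (Rpower h (mu i) * G i h)) (S d)) in *.
  set (u := fun h => Rpower h (- mu (S d)) * / G (S d) h).
  set (uf := fun h => sum_n (fun i => c i * (Rpower h (mu i - mu (S d)) * Q i h)) d + c (S d)).
  set (duf := fun h => sum_n (fun i => c i * (Rpower h (mu i - mu (S d) - 1) * G' i h)) d).
  assert (Ef : forall x, 0 < x < eps -> u x * f x = uf x).
  { intros x Hx; unfold u, f, uf; rewrite sum_Sn; unfold plus; simpl.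
    rewrite Rmult_plus_distr_l, <- (sum_n_mult_l (K := R_Ring)); f_equal.
    - apply sum_n_ext; intros i; unfold mult, Q; simpl.
      unfold Rminus; rewrite Rpower_plus; ring.
    - rewrite Rpower_Ropp; field; split; [apply Ne; lra|].
      pose proof (Rpower_gt_0 x (mu (S d))); lra. }
  assert (Duf : forall x, 0 < x < eps -> is_derive uf x (duf x)).
  { intros x Hx; unfold uf, duf.
    rewrite <- (Rplus_0_r (sum_n _ d)).
    apply (is_derive_plus (V := R_NormedModule)); [|apply (is_derive_const (c (S d)) x)].
    apply (is_derive_sum_n (V := R_NormedModule)); intros i Hi.
    apply (is_derive_scal (fun h => Rpower h (mu i - mu (S d)) * Q i h) x (c i)).
    replace (Rpower x (mu i - mu (S d) - 1) * G' i x) with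
      ((mu i - mu (S d)) * Rpower x (mu i - mu (S d) - 1) * Q i x
       + Rpower x (mu i - mu (S d)) * Derive (Q i) x).
    - apply (is_derive_mult (fun h => Rpower h (mu i - mu (S d))) (Q i) x).
      + apply Rpower_is_derive; lra.
      + apply Ck_is_derive with (- e) e O; [apply SQ; lia|lra].
      + intros; apply Rmult_comm.
    - unfold G'.
      replace (Rpower x (mu i - mu (S d))) with
        (x * Rpower x (mu i - mu (S d) - 1)); [ring|].
      rewrite <- (Rpower_1 x) at 1 by lra; rewrite <- Rpower_plus; f_equal; ring. }
  assert (Sf : smooth 0 eps f).
  { intros k; unfold f; apply Ck_sum; intros i Hi.
    apply Ck_mult; [apply Ck_const|apply Ck_mult; [apply Ck_Rpower; lra|]].
    apply Ck_sub with (- del) del; try lra; apply HG; auto. }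
  assert (Su : smooth 0 eps u).
  { intros k; apply Ck_mult; [apply Ck_Rpower; lra|].
    apply Ck_sub with (- e) e; try lra; apply Ck_inv; auto.
    apply Ck_sub with (- del) del; try lra; apply Sm. }
  assert (Suf : smooth 0 eps uf).
  { intros k; apply Ck_ext with (fun x => u x * f x); auto; apply Ck_mult; auto. }
  assert (Zuf : zero_list uf 0 eps l).
  { destruct Zl as [Hs Z]; split; auto; intros z m H.
    destruct (Z z m H) as (Hz & Hm & V); split; [|split]; auto.
    apply vanish_ext with 0 eps (fun x => u x * f x); auto.
    apply vanish_mult with 0 eps; auto. }
  (* if only the last coefficient survives, uf is a nonzero constant *)
  destruct (classic (exists i, (i <= d)%nat /\ c i <> 0)) as [Hc'|Hc'].
  + destruct l as [|[z m] l]; [simpl; lia|].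
    destruct (Rolle_mult _ _ _ Suf _ _ _ Zuf) as (l' & [Hs' Z'] & E & _).
    rewrite <- E; apply le_n_S, (B c Hc'); split; auto.
    intros z' m' H; destruct (Z' z' m' H) as (Hz & Hm & V); split; [|split]; auto.
    apply vanish_ext with 0 eps (Derive uf); auto.
    intros x Hx; apply is_derive_unique; auto.
  + assert (c0 : forall i, (i <= d)%nat -> c i = 0).
    { intros i Hi; apply NNPP; intros H; apply Hc'; eauto. }
    rewrite (zero_list_nil_of_nonzero uf 0 eps l); auto; [simpl; lia|].
    intros x Hx; unfold uf.
    rewrite (sum_n_ext_loc _ (fun _ => 0)).
    * rewrite sum_n_const, Rmult_0_r, Rplus_0_l.
      destruct Hc as (i & Hi & Hc).
      destruct (Nat.eq_dec i (S d)) as [<-|]; auto; rewrite c0 in Hc; [tauto|lia].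
    * intros i Hi; rewrite c0; auto; apply Rmult_0_l.
Qed.

(** * Counting zeros exactly *)

(** Enumeration of the indices other than p. *)
Definition skip (p i : nat) : nat := if lt_dec i p then i else S i.

Lemma sum_n_skip (g : nat -> R) d : forall p, (p <= S d)%nat ->
  sum_n g (S d) = g p + sum_n (fun i => g (skip p i)) d.
Proof.
induction d as [|d IH]; intros p Hp.
- rewrite sum_Sn, !sum_O; unfold plus, skip; simpl.
  destruct p as [|[|p]]; simpl; [ring|ring|lia].
- rewrite sum_Sn; destruct (Nat.eq_dec p (S (S d))) as [->|].
  + rewrite Rplus_comm; f_equal; apply sum_n_ext_loc; intros i Hi.
    unfold skip; destruct (lt_dec i (S (S d))); auto; lia.
  + rewrite (IH p), sum_Sn by lia; unfold plus; simpl.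
    replace (skip p (S d)) with (S (S d)); [ring|].
    unfold skip; destruct (lt_dec (S d) p); auto; lia.
Qed.

(** Induction on d, eliminating an unknown p with nonzero coefficient in the last
    equation. *)
Lemma linear_system_nontrivial d : forall A : nat -> nat -> R,
  exists c : nat -> R, (exists i, (i <= d)%nat /\ c i <> 0) /\
    forall j, (j < d)%nat -> sum_n (fun i => c i * A i j) d = 0.
Proof.
induction d as [|d IH]; intros A.
- exists (fun _ => 1); split; [exists O; split; [lia|lra]|intros; lia].
- destruct (classic (exists p, (p <= S d)%nat /\ A p d <> 0)) as [(p & Hp & Np)|H].
  + destruct (IH (fun i j => A (skip p i) j - A (skip p i) d / A p d * A p j))
      as (c & (i & Hi & Hc) & E).
    set (cp := - sum_n (fun i => c i * A (skip p i) d) d / A p d).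
    set (c' := fun k => if Nat.eq_dec k p then cp else
                        if lt_dec k p then c k else c (pred k)).
    assert (Hs : forall i, c' (skip p i) = c i).
    { intros k; unfold c', skip; destruct (lt_dec k p).
      - destruct (Nat.eq_dec k p); [lia|destruct (lt_dec k p); auto; lia].
      - destruct (Nat.eq_dec (S k) p); [lia|destruct (lt_dec (S k) p); auto; lia]. }
    assert (Hcp : c' p = cp) by (unfold c'; destruct (Nat.eq_dec p p); tauto).
    assert (S' : forall j, sum_n (fun k => c' k * A k j) (S d) =
                 cp * A p j + sum_n (fun i => c i * A (skip p i) j) d).
    { intros j; rewrite (sum_n_skip _ _ p Hp), Hcp; f_equal.
      apply sum_n_ext; intros k; now rewrite Hs. }
    exists c'; split.
    * exists (skip p i); rewrite Hs; split; auto.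
      unfold skip; destruct (lt_dec i p); lia.
    * intros j Hj; rewrite S'; destruct (Nat.eq_dec j d) as [->|].
      -- real_eq; unfold cp; field; auto.
      -- assert (E' : sum_n (fun i => c i * A (skip p i) j) d +
           - (A p j / A p d) * sum_n (fun i => c i * A (skip p i) d) d = 0).
         { rewrite <- (E j) by lia.
           rewrite <- (sum_n_mult_l (K := R_Ring)), <- (sum_n_plus (G := R_AbelianMonoid)).
           apply sum_n_ext; intros k; unfold plus, mult; simpl; real_eq; field; auto. }
         rewrite <- E'; unfold cp; real_eq; field; auto.
  + destruct (IH A) as (c & (i & Hi & Hc) & E).
    exists (fun k => if le_dec k d then c k else 0); split.
    * exists i; split; [lia|]; destruct (le_dec i d); tauto.
    * intros j Hj; rewrite sum_Sn.
      destruct (le_dec (S d) d); [lia|]; unfold plus; simpl; rewrite Rmult_0_l, Rplus_0_r.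
      destruct (Nat.eq_dec j d) as [->|].
      -- rewrite (sum_n_ext_loc _ (fun _ => 0)); [rewrite sum_n_const; apply Rmult_0_r|].
         intros k Hk; replace (A k d) with 0; [apply Rmult_0_r|].
         symmetry; apply NNPP; intros N; apply H; exists k; split; auto; lia.
      -- rewrite <- (E j) by lia; apply sum_n_ext_loc; intros k Hk.
         destruct (le_dec k d); [reflexivity|lia].
Qed.

Lemma fst_lt_insert (p : R * nat) l : StronglySorted fst_lt l -> ~ In (fst p) (map fst l) ->
  exists l', StronglySorted fst_lt l' /\ Permutation (p :: l) l'.
Proof.
induction l as [|q l IH]; intros Hs N.
- exists [p]; split; [repeat constructor|auto].
- apply StronglySorted_inv in Hs; destruct Hs as [Hs Hq].
  destruct (Rtotal_order (fst p) (fst q)) as [L|[E|L]].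
  + exists (p :: q :: l); split; auto.
    constructor; [now constructor|constructor; auto].
    eapply Forall_impl; [|exact Hq]; intros r; unfold fst_lt; lra.
  + exfalso; apply N; left; auto.
  + destruct IH as (l' & Hs' & P); auto; [intros H; apply N; now right|].
    exists (q :: l'); split.
    * constructor; auto; apply Forall_forall; intros r Hr.
      apply (Permutation_in r (Permutation_sym P)) in Hr.
      destruct Hr as [<-|Hr]; auto; revert r Hr; now apply Forall_forall.
    * rewrite perm_swap; auto.
Qed.

Lemma fst_lt_sort l : NoDup (map fst l) ->
  exists l', StronglySorted fst_lt l' /\ Permutation l l'.
Proof.
induction l as [|p l IH]; intros N; [exists []; split; auto; constructor|].
inversion N; subst; destruct IH as (l1 & Hs & P); auto.
destruct (fst_lt_insert p l1) as (l' & Hs' & P'); auto.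
- intros H; apply H1, (Permutation_in _ (Permutation_sym (Permutation_map fst P))), H.
- exists l'; split; auto; rewrite <- P'; auto.
Qed.

Lemma list_sum_perm l l' : Permutation l l' -> list_sum l = list_sum l'.
Proof. induction 1; simpl; lia. Qed.

Lemma length_le_list_sum (l : list (R * nat)) : (forall z m, In (z, m) l -> (1 <= m)%nat) ->
  (length l <= list_sum (map snd l))%nat.
Proof.
induction l as [|[z m] l IH]; intros H; simpl; auto.
pose proof (H z m (or_introl eq_refl)).
assert (length l <= list_sum (map snd l))%nat by (apply IH; intros; eapply H; right; eauto).
lia.
Qed.

Lemma NoDup_points (x : nat -> R) n :
  (forall i j, (i < j < n)%nat -> x i <> x j) -> NoDup (map x (seq 0 n)).
Proof.
induction n as [|n IH]; intros D; [constructor|].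
rewrite seq_S, map_app; apply NoDup_app; simpl.
- apply IH; intros; apply D; lia.
- repeat constructor; simpl; tauto.
- intros y Hy [<-|[]]; apply in_map_iff in Hy; destruct Hy as (i & E & Hi).
  apply in_seq in Hi; apply (D i n); auto; lia.
Qed.

Section BoundedZeros.

Variables (f : R -> R) (a b : R) (d : nat).
Hypothesis f_smooth : smooth a b f.
Hypothesis f_bound : forall l, zero_list f a b l -> (list_sum (map snd l) <= d)%nat.

Lemma unsorted_bound l : NoDup (map fst l) ->
  (forall z m, In (z, m) l -> a < z < b /\ (1 <= m)%nat /\ vanish f z m) ->
  (list_sum (map snd l) <= d)%nat.
Proof using f_bound.
intros N Z; destruct (fst_lt_sort l N) as (l' & Hs & P).
rewrite (list_sum_perm _ _ (Permutation_map snd P)); apply f_bound; split; auto.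
intros z m H; apply Z, (Permutation_in _ (Permutation_sym P)), H.
Qed.

Lemma distinct_zeros_le (x : nat -> R) n :
  (forall i, (i < n)%nat -> a < x i < b /\ f (x i) = 0) ->
  (forall i j, (i < j < n)%nat -> x i <> x j) -> (n <= d)%nat.
Proof using f_bound.
intros Zx Dx; set (l := map (fun i => (x i, 1%nat)) (seq 0 n)).
assert (Z : forall z m, In (z, m) l -> a < z < b /\ (1 <= m)%nat /\ vanish f z m).
{ intros z m H; apply in_map_iff in H; destruct H as (i & E & Hi).
  injection E as <- <-; apply in_seq in Hi.
  split; [apply Zx; lia|split; auto].
  intros [|j] Hj; [apply (Zx i); lia|lia]. }
apply Nat.le_trans with (list_sum (map snd l)).
- replace n with (length l) by (unfold l; now rewrite length_map, length_seq).
  apply length_le_list_sum; apply Z.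
- apply unsorted_bound; auto.
  unfold l; rewrite map_map; apply NoDup_points; auto.
Qed.

(** A zero of order above d would by itself exceed the bound, so some derivative
    is nonzero; the least such order is the multiplicity. *)
Lemma zero_mult_exists z : a < z < b -> f z = 0 ->
  exists m, (1 <= m)%nat /\ zero_mult f z m /\ vanish f z m.
Proof using f_smooth f_bound.
intros Hz fz.
assert (D : forall j, is_derive_n f j z (Derive_n f j z)).
{ intros j; apply Derive_n_correct, Ck_ex_derive_n with a b; auto. }
assert (H : exists m, Derive_n f m z <> 0).
{ apply NNPP; intros N.
  assert (H : (list_sum (map snd [(z, S d)]) <= d)%nat); [|simpl in H; lia].
  apply unsorted_bound; [repeat constructor; simpl; tauto|].
  intros z' m' [E|[]]; injection E as <- <-; split; [|split]; auto; [lia|].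
  intros j _; apply NNPP; intros Nj; apply N; eauto. }
destruct (dec_inh_nat_subset_has_unique_least_element
  (fun m => Derive_n f m z <> 0) (fun m => classic _) H) as (m & [Hm L] & _).
assert (V : vanish f z m).
{ intros j Hj; apply NNPP; intros Nj; apply L in Nj; lia. }
exists m; split; [|split]; auto.
- destruct m; [simpl in Hm; tauto|lia].
- split; [intros j Hj; rewrite <- (V j Hj); auto|exists (Derive_n f m z); auto].
Qed.

(** A list of zeros that misses one can be extended; the bound d on its length
    makes k = S d - length l a termination measure. *)
Lemma zero_count_extend k : forall l, (k + length l = S d)%nat -> NoDup (map fst l) ->
  (forall z m, In (z, m) l -> a < z < b /\ (1 <= m)%nat /\ zero_mult f z m /\ vanish f z m) ->
  exists l', incl l l' /\ zero_count f a b (list_sum (map snd l')) /\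
    (list_sum (map snd l') <= d)%nat.
Proof using f_smooth f_bound.
assert (Len : forall l, NoDup (map fst l) ->
  (forall z m, In (z, m) l -> a < z < b /\ (1 <= m)%nat /\ zero_mult f z m /\ vanish f z m) ->
  (list_sum (map snd l) <= d /\ length l <= d)%nat).
{ intros l N Z.
  assert (list_sum (map snd l) <= d)%nat.
  { apply unsorted_bound; auto; intros z m H; destruct (Z z m H); tauto. }
  pose proof (length_le_list_sum l (fun z m H => proj1 (proj2 (Z z m H)))); lia. }
induction k as [|k IH]; intros l E N Z; [destruct (Len l N Z); lia|].
destruct (classic (exists z, (a < z < b /\ f z = 0) /\ ~ In z (map fst l)))
  as [(z & [Hz fz] & Nz)|H].
- destruct (zero_mult_exists z Hz fz) as (m & Hm & M & V).
  destruct (IH ((z, m) :: l)) as (l' & I' & C').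
  + simpl; lia.
  + now constructor.
  + intros z' m' [E'|H']; [injection E' as <- <-; auto|auto].
  + exists l'; split; auto; intros p Hp; apply I'; now right.
- exists l; split; [apply incl_refl|]; split; [|apply Len; auto].
  exists l; split; [|split; [|split]]; auto.
  + intros z; split.
    * intros Hz; apply in_map_iff in Hz; destruct Hz as ([z' m] & <- & Hz).
      destruct (Z z' m Hz) as (Hz' & Hm & _ & V); split; auto; apply (V O); lia.
    * intros Hz; apply NNPP; intros Nz; apply H; eauto.
  + intros z m Hz; apply (Z z m Hz).
Qed.

Lemma zero_count_exists : exists N, zero_count f a b N /\ (N <= d)%nat.
Proof using f_smooth f_bound.
destruct (zero_count_extend (S d) []) as (l & _ & C & L).
- simpl; lia.
- constructor.
- intros z m [].
- eauto.
Qed.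

Lemma zero_count_sharp (x : nat -> R) :
  (forall i, (i < d)%nat -> a < x i < b /\ f (x i) = 0) ->
  (forall i j, (i < j < d)%nat -> x i <> x j) -> zero_count f a b d.
Proof using f_smooth f_bound.
intros Zx Dx.
destruct zero_count_exists as (N & (l & Nd & Zl & Ml & <-) & HN).
enough (E : list_sum (map snd l) = d) by (exists l; auto).
apply Nat.le_antisymm; auto.
apply Nat.le_trans with (length l).
- rewrite <- (length_map fst l).
  replace d with (length (map x (seq 0 d))) by now rewrite length_map, length_seq.
  apply NoDup_incl_length.
  + apply NoDup_points; auto.
  + intros y Hy; apply in_map_iff in Hy; destruct Hy as (i & <- & Hi).
    apply in_seq in Hi; apply Zl, Zx; lia.
- apply length_le_list_sum; intros z m H.
  destruct m; [exfalso|lia].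
  destruct (Ml z _ H) as (_ & c & Nc & Ec); simpl in Ec.
  apply Nc; rewrite <- Ec; apply Zl, in_map_iff; exists (z, O); auto.
Qed.

End BoundedZeros.

Lemma zero_count_ext f g a b N : (forall x, a < x < b -> f x = g x) ->
  zero_count f a b N -> zero_count g a b N.
Proof.
intros E (l & Nd & Zl & Ml & S').
assert (L : forall x j c, a < x < b -> is_derive_n f j x c -> is_derive_n g j x c).
{ intros x j c Hx; apply is_derive_n_ext_loc, (locally_open_interval a b); auto. }
exists l; split; [|split; [|split]]; auto.
- intros z; rewrite (Zl z); split; intros [Hz H]; split; auto;
    [rewrite <- E|rewrite E]; auto.
- intros z m H.
  assert (Hz : a < z < b) by (apply (Zl z), in_map_iff; exists (z, m); auto).
  destruct (Ml z m H) as [V (c & Nc & D)]; split; eauto.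
Qed.

(** Any d points near 0 are the zeros of some combination of d + 1 functions,
    and by the bound these zeros are simple and are all the zeros. *)
Lemma power_system_zeros d (mu : nat -> R) (G : nat -> R -> R) (del : R) :
  0 < del ->
  (forall i j, (i < j <= d)%nat -> mu i <> mu j) ->
  (forall i, (i <= d)%nat -> G i 0 <> 0 /\ smooth (- del) del (G i)) ->
  let F := fun (c : nat -> R) h => sum_n (fun i => c i * (Rpower h (mu i) * G i h)) d in
  exists eps0, 0 < eps0 < 1 /\
    (forall c, (exists i, (i <= d)%nat /\ c i <> 0) ->
      exists N, zero_count (F c) 0 eps0 N /\ (N <= d)%nat) /\
    (forall eps, 0 < eps <= eps0 ->
      exists c, nonzero_on (F c) 0 eps /\ zero_count (F c) 0 eps d).
Proof.
intros Hdel Hmu HG F.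
destruct (power_system_bound d mu G del Hdel Hmu HG) as (e & He & B).
assert (Hm : 0 < Rmin e (/ 2)) by (apply Rmin_pos; lra).
pose proof (Rmin_l e (/ 2)); pose proof (Rmin_r e (/ 2)).
assert (SF : forall c eps, 0 < eps <= e -> smooth 0 eps (F c)).
{ intros c eps Heps k; unfold F; apply Ck_sum; intros i Hi.
  apply Ck_mult; [apply Ck_const|apply Ck_mult; [apply Ck_Rpower; lra|]].
  apply Ck_sub with (- del) del; try lra; apply HG; auto. }
assert (BF : forall c eps, (exists i, (i <= d)%nat /\ c i <> 0) -> 0 < eps <= e ->
  forall l, zero_list (F c) 0 eps l -> (list_sum (map snd l) <= d)%nat).
{ intros c eps Hc Heps l [Hs Z]; apply (B c Hc); split; auto.
  intros z m H1; destruct (Z z m H1); split; [lra|tauto]. }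
exists (Rmin e (/ 2)); split; [lra|]; split.
- intros c Hc; apply zero_count_exists; [apply SF; lra|apply BF; auto; lra].
- intros eps Heps.
  set (x := fun j => eps * (/ (INR j + 2))).
  assert (Hx : forall j, 0 < x j < eps).
  { intros j; unfold x; pose proof (pos_INR j).
    assert (0 < / (INR j + 2) < 1).
    { split; [apply Rinv_0_lt_compat; lra|rewrite <- Rinv_1; apply Rinv_lt_contravar; lra]. }
    nra. }
  assert (Dx : forall i j, (i < j)%nat -> x i <> x j).
  { intros i j Hij E; apply Rmult_eq_reg_l in E; [|lra].
    apply Rinv_eq_reg in E; apply lt_INR in Hij; lra. }
  destruct (linear_system_nontrivial d (fun i j => Rpower (x j) (mu i) * G i (x j)))
    as (c & Hc & E).
  assert (C : zero_count (F c) 0 eps d).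
  { apply zero_count_sharp with x.
    - apply SF; lra.
    - apply BF; auto; lra.
    - intros i Hi; split; auto; apply (E i Hi).
    - intros i j Hij; apply Dx; lia. }
  exists c; split; auto.
  (* x d would be a zero too many *)
  exists (x d); split; auto; intros Fd.
  enough (S d <= d)%nat by lia.
  apply (distinct_zeros_le (F c) 0 eps d) with x; [apply BF; auto; lra| |].
  + intros i Hi; split; auto; destruct (Nat.eq_dec i d) as [->|]; auto; apply E; lia.
  + intros i j Hij; apply Dx; lia.
Qed.

(** * Subspaces and polynomials *)

Record subspace {X : Type} (V : (X -> R) -> Prop) : Prop := {
  subspace_0 : V (fun _ => 0);
  subspace_lin : forall f g c, V f -> V g -> V (fun x => f x + c * g x);
  subspace_ext : forall f g, (forall x, f x = g x) -> V f -> V g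
}.

Lemma subspace_scal {X} (V : (X -> R) -> Prop) f c :
  subspace V -> V f -> V (fun x => c * f x).
Proof.
intros HV Hf; apply (subspace_ext V HV (fun x => 0 + c * f x)); [intros; ring|].
apply (subspace_lin V HV); auto; apply (subspace_0 V HV).
Qed.

Lemma subspace_sum {X} (V : (X -> R) -> Prop) (c : nat -> R) (f : nat -> X -> R) n :
  subspace V -> (forall i, (i <= n)%nat -> V (f i)) ->
  V (fun x => sum_n (fun i => c i * f i x) n).
Proof.
intros HV; induction n as [|n IH]; intros H.
- apply (subspace_ext V HV (fun x => c O * f O x)); [intros x; now rewrite sum_O|].
  apply subspace_scal; auto.
- apply (subspace_ext V HV (fun x => sum_n (fun i => c i * f i x) n + c (S n) * f (S n) x)).
  + intros x; now rewrite sum_Sn.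
  + apply (subspace_lin V HV); auto.
Qed.

(** Degree at most n. The Horner form makes division by a linear factor a
    structural induction. *)
Fixpoint polynomial (n : nat) (p : R -> R) : Prop :=
  match n with
  | O => exists c, forall x, p x = c
  | S n => exists c q, polynomial n q /\ forall x, p x = c + x * q x
  end.

Lemma poly_ext n p q : (forall x, p x = q x) -> polynomial n p -> polynomial n q.
Proof.
destruct n; simpl; intros E.
- intros [c H]; exists c; intros; now rewrite <- E.
- intros (c & r & Hr & H); exists c, r; split; auto; intros; now rewrite <- E.
Qed.

Lemma poly_const n : forall c, polynomial n (fun _ => c).
Proof.
induction n as [|n IH]; intros c; [exists c; auto|].
exists c, (fun _ => 0); split; auto; intros; ring.
Qed.

Lemma poly_lin n : forall p q c, polynomial n p -> polynomial n q -> polynomial n (fun x => p x + c * q x).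
Proof.
induction n as [|n IH]; intros p q c; simpl.
- intros [a Ha] [b Hb]; exists (a + c * b); intros; now rewrite Ha, Hb.
- intros (a & p' & Pp & Ea) (b & q' & Pq & Eb).
  exists (a + c * b), (fun x => p' x + c * q' x); split; auto.
  intros; rewrite Ea, Eb; ring.
Qed.

Lemma poly_S n : forall p, polynomial n p -> polynomial (S n) p.
Proof.
induction n as [|n IH]; intros p.
- intros [c H]; exists c, (fun _ => 0); split; [apply (poly_const 0)|].
  intros; rewrite H; ring.
- intros (c & q & Hq & H); exists c, q; split; auto.
Qed.

Lemma poly_le n m p : (n <= m)%nat -> polynomial n p -> polynomial m p.
Proof. induction 1; auto; intros; apply poly_S; auto. Qed.

Lemma poly_mul_linear n p a : polynomial n p -> polynomial (S n) (fun x => p x * (x - a)).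
Proof.
intros P; apply poly_ext with (fun x => x * p x + - a * p x); [intros; ring|].
apply poly_lin; [|apply poly_S; auto].
exists 0, p; split; auto; intros; ring.
Qed.

Lemma poly_divide a n : forall p, polynomial (S n) p ->
  exists q, polynomial n q /\ forall x, p x = p a + (x - a) * q x.
Proof.
induction n as [|n IH]; intros p (c & p1 & H1 & E).
- exists p1; split; auto; destruct H1 as [d Ed]; intros x.
  rewrite !E, !Ed; ring.
- destruct (IH p1 H1) as (q1 & Hq & E1).
  exists (fun x => p1 x + a * q1 x); split.
  + apply poly_lin; auto; apply poly_S; auto.
  + intros x; rewrite !E.
    replace (x * p1 x) with (a * p1 x + (x - a) * p1 x) by ring.
    rewrite (E1 x) at 1; ring.
Qed.

(** Products over the first r nodes: powers when all nodes are 0, falling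
    factorials when the nodes are 0, 1, 2, and so on. *)
Fixpoint node_prod (a : nat -> R) (r : nat) (x : R) : R :=
  match r with
  | O => 1
  | S r => node_prod a r x * (x - a r)
  end.

Lemma poly_node_prod a p n r : polynomial n p -> polynomial (n + r) (fun x => p x * node_prod a r x).
Proof.
induction r as [|r IH]; intros P; simpl.
- rewrite Nat.add_0_r; apply poly_ext with p; auto; intros; ring.
- rewrite Nat.add_succ_r.
  apply poly_ext with (fun x => p x * node_prod a r x * (x - a r)); [intros; ring|].
  apply poly_mul_linear; auto.
Qed.

Lemma node_prod_add a r s x :
  node_prod a (r + s) x = node_prod a r x * node_prod (fun t => a (r + t)%nat) s x.
Proof.
induction s as [|s IH]; simpl; [rewrite Nat.add_0_r; ring|].
rewrite Nat.add_succ_r; simpl; rewrite IH; ring.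
Qed.

Lemma node_prod_neq_0 a r x : (forall t, (t < r)%nat -> x <> a t) -> node_prod a r x <> 0.
Proof.
induction r as [|r IH]; intros N; simpl; [lra|].
apply Rmult_integral_contrapositive_currified; auto.
intros E; apply (N r); auto; lra.
Qed.

Lemma node_prod_eq_0 a r t : (t < r)%nat -> node_prod a r (a t) = 0.
Proof.
induction r as [|r IH]; intros Ht; [lia|]; simpl.
destruct (Nat.eq_dec t r) as [->|]; [ring|rewrite IH; [ring|lia]].
Qed.

(** Newton interpolation, by repeated division by x - a r. The weight w and the
    argument g make it apply to coefficient sequences as well as to integrands. *)
Lemma poly_in_span {X} (V : (X -> R) -> Prop) (a : nat -> R) (w g : X -> R) n :
  subspace V -> (forall r, (r <= n)%nat -> V (fun x => w x * node_prod a r (g x))) ->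
  forall p, polynomial n p -> V (fun x => w x * p (g x)).
Proof.
intros HV H.
assert (G : forall k r p, (r + k <= n)%nat -> polynomial k p ->
  V (fun x => w x * (node_prod a r (g x) * p (g x)))).
{ induction k as [|k IH]; intros r p Hr P.
  - destruct P as [c E].
    apply (subspace_ext V HV (fun x => c * (w x * node_prod a r (g x)))).
    + intros x; rewrite E; ring.
    + apply subspace_scal; auto; apply H; lia.
  - destruct (poly_divide (a r) k p P) as (q & Hq & E).
    apply (subspace_ext V HV (fun x =>
      w x * (node_prod a (S r) (g x) * q (g x)) +
      p (a r) * (w x * node_prod a r (g x)))).
    + intros x; rewrite (E (g x)); simpl; ring.
    + apply (subspace_lin V HV); [apply IH; auto; lia|apply H; lia]. }
intros p P; apply (subspace_ext V HV (fun x => w x * (node_prod a O (g x) * p (g x)))).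
- intros; simpl; ring.
- apply (G n O); auto.
Qed.

(** * Coefficient sequences *)

Definition falling (r m : nat) : R := node_prod INR r (INR m).
Definition half (t : nat) : R := INR t + / 2.

Lemma INR_neq_half m t : INR m <> half t.
Proof.
unfold half; intros E.
assert (E2 : INR (2 * m) = INR (2 * t + 1)).
{ rewrite plus_INR, !mult_INR; simpl; lra. }
apply INR_eq in E2; lia.
Qed.

Lemma half_prod_neq_0 j m : node_prod half j (INR m) <> 0.
Proof. apply node_prod_neq_0; intros; apply INR_neq_half. Qed.

Lemma falling_half_neq_0 r t : node_prod INR r (half t) <> 0.
Proof. apply node_prod_neq_0; intros s _ E; apply (INR_neq_half s t); auto. Qed.

Section Sequences.

Variable w : nat -> R.

(** Coefficients of the power series of the integral of u ^ i * y ^ (s + 2 j),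
    up to a constant factor; w m are those for i = j = 0. *)
Definition moment_seq (i j m : nat) : R :=
  w m * (node_prod INR (i + j) (INR m) /
         (node_prod half j (INR m) * node_prod half (i + j) (INR m))).

Definition rational_seq (n K : nat) (p : R -> R) (m : nat) : R :=
  w m * (p (INR m) / (node_prod half K (INR m) * node_prod half (n + K) (INR m))).

(** Extending both denominators to the common ones multiplies the numerator by
    the missing linear factors, K - j and n + K - i - j of them. *)
Lemma moment_seq_rational n K i j : (i <= n)%nat -> (j <= K)%nat ->
  exists p, polynomial (n + 2 * K) p /\ forall m, moment_seq i j m = rational_seq n K p m.
Proof.
intros Hi Hj.
exists (fun x => node_prod INR (i + j) x * node_prod (fun t => half (j + t)) (K - j) x *
            node_prod (fun t => half (i + j + t)) (n + K - (i + j)) x); split.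
- apply poly_le with (0 + (i + j) + (K - j) + (n + K - (i + j)))%nat; [lia|].
  apply (poly_node_prod _ (fun x => node_prod INR (i + j) x * node_prod _ (K - j) x)).
  apply (poly_node_prod _ (fun x => node_prod INR (i + j) x)).
  apply poly_ext with (fun x => 1 * node_prod INR (i + j) x); [intros; ring|].
  apply (poly_node_prod _ (fun _ => 1)), poly_const.
- intros m; unfold moment_seq, rational_seq; f_equal.
  assert (Split : forall a b, (a <= b)%nat -> node_prod half b (INR m) =
    node_prod half a (INR m) * node_prod (fun t => half (a + t)) (b - a) (INR m)).
  { intros a b Hab; rewrite <- (node_prod_add half); f_equal; lia. }
  rewrite (Split j K), (Split (i + j)%nat (n + K)%nat) by lia.
  assert (N : forall a b, node_prod (fun t => half (a + t)) b (INR m) <> 0)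
    by (intros; apply node_prod_neq_0; intros; apply INR_neq_half).
  pose proof (half_prod_neq_0 j m); pose proof (half_prod_neq_0 (i + j) m).
  field; auto.
Qed.

Variable V : (nat -> R) -> Prop.
Hypothesis HV : subspace V.

(** The multiple of the sequence of largest i that agrees with p at the last
    pole is subtracted; the difference is divisible by the last linear factor. *)
Lemma rational_in_span_0 n : (forall i, (i <= n)%nat -> V (moment_seq i 0)) ->
  forall p, polynomial n p -> V (rational_seq n 0 p).
Proof using HV.
induction n as [|n IH]; intros H p P.
- destruct P as [c E].
  apply (subspace_ext V HV (fun m => c * moment_seq 0 0 m)).
  + intros m; unfold moment_seq, rational_seq; simpl; rewrite E; field.
  + apply subspace_scal; auto.
- set (a := p (half n) / node_prod INR (n + 1) (half n)).
  destruct (poly_divide (half n) n (fun x => p x + - a * (1 * node_prod INR (n + 1) x)))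
    as (q & Hq & E).
  { apply poly_lin; auto.
    apply poly_le with (0 + (n + 1))%nat; [lia|].
    apply (poly_node_prod _ (fun _ => 1)), poly_const. }
  assert (E' : forall x, p x = (x - half n) * q x + a * node_prod INR (n + 1) x).
  { intros x; specialize (E x); cbv beta in E.
    assert (Ea : p (half n) + - a * (1 * node_prod INR (n + 1) (half n)) = 0)
      by (unfold a; field; apply falling_half_neq_0).
    rewrite Ea in E; clear Ea; clearbody a; lra. }
  apply (subspace_ext V HV (fun m => rational_seq n 0 q m + a * moment_seq (n + 1) 0 m)).
  + intros m; unfold moment_seq, rational_seq; rewrite E'.
    rewrite !Nat.add_0_r, Nat.add_1_r; simpl.
    pose proof (half_prod_neq_0 n m); pose proof (INR_neq_half m n).
    field; split; auto; lra.
  + apply (subspace_lin V HV); [apply IH; auto; intros; apply H; lia|apply H; lia].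
Qed.

(** Induction on K: the two new factors of the denominator are cancelled by
    subtracting multiples of the two sequences with j = K and i = n, n - 1, which
    requires n > 0. *)
Lemma rational_in_span n K : (1 <= n)%nat ->
  (forall i j, (i <= n)%nat -> (j <= K)%nat -> V (moment_seq i j)) ->
  forall p, polynomial (n + 2 * K) p -> V (rational_seq n K p).
Proof using HV.
intros Hn; induction K as [|K IH]; intros H p P.
- simpl in P; rewrite Nat.add_0_r in P; apply rational_in_span_0; auto.
- replace (n + 2 * S K)%nat with (S (S (n + 2 * K))) in P by lia.
  assert (Pf : forall r d, (r <= d)%nat -> polynomial d (fun x => 1 * node_prod INR r x)).
  { intros r d Hr; apply poly_le with (0 + r)%nat; [lia|].
    apply (poly_node_prod _ (fun _ => 1)), poly_const. }
  (* a and b make the numerators vanish at the poles half (n + K) and half K *)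
  set (a := p (half (n + K)) / node_prod INR (S (n + K)) (half (n + K))).
  destruct (poly_divide (half (n + K)) _
    (fun x => p x + - a * (1 * node_prod INR (S (n + K)) x))
    (poly_lin _ _ _ _ P (Pf (S (n + K)) (S (S (n + 2 * K))) ltac:(lia))))
    as (q & Hq & E).
  set (b := q (half K) / node_prod INR (n + K) (half K)).
  destruct (poly_divide (half K) _
    (fun x => q x + - b * (1 * node_prod INR (n + K) x))
    (poly_lin _ _ _ _ Hq (Pf (n + K)%nat (S (n + 2 * K)) ltac:(lia))))
    as (q' & Hq' & E').
  assert (E1 : forall x, p x = (x - half (n + K)) * ((x - half K) * q' x +
     b * node_prod INR (n + K) x) + a * node_prod INR (S (n + K)) x).
  { intros x; specialize (E x); specialize (E' x); cbv beta in E, E'.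
    assert (Ea : p (half (n + K)) + - a * (1 * node_prod INR (S (n + K)) (half (n + K))) = 0)
      by (unfold a; field; apply falling_half_neq_0).
    assert (Eb : q (half K) + - b * (1 * node_prod INR (n + K) (half K)) = 0)
      by (unfold b; field; apply falling_half_neq_0).
    rewrite Ea in E; rewrite Eb in E'; clear Ea Eb; clearbody a b.
    replace (p x) with ((x - half (n + K)) * q x + a * node_prod INR (S (n + K)) x) by lra.
    replace (q x) with ((x - half K) * q' x + b * node_prod INR (n + K) x) by lra.
    ring. }
  apply (subspace_ext V HV (fun m => rational_seq n K q' m +
    b * moment_seq (n - 1) (S K) m + a * moment_seq n (S K) m)).
  + intros m; unfold moment_seq, rational_seq; rewrite E1.
    replace (n - 1 + S K)%nat with (n + K)%nat by lia.
    rewrite Nat.add_succ_r; cbn [node_prod].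
    pose proof (half_prod_neq_0 K m); pose proof (half_prod_neq_0 (n + K) m).
    pose proof (INR_neq_half m K); pose proof (INR_neq_half m (n + K)).
    field; repeat split; auto; lra.
  + apply (subspace_lin V HV); [apply (subspace_lin V HV)|]; try (apply H; lia).
    apply IH; auto.
Qed.

End Sequences.

(** Dimension of the span of the sequences with i <= n and j < k. For n > 0 the
    span consists of all numerators of degree at most n + 2 K over the common
    denominator, K = k - 1, and the (n + 1) k generating sequences are dependent
    as soon as n > 1 and k > 1; for n = 0 the k sequences are independent. *)
Definition class_dim (n k : nat) : nat :=
  match k with
  | O => O
  | S K => if Nat.eqb n 0 then k else S (n + 2 * K)
  end.

(** Since the r-th sequence starts at index r, its power series is h ^ r times a
    function that does not vanish at 0. *)
Definition basis_seq (w : nat -> R) (n k r m : nat) : R :=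
  if Nat.eqb n 0 then moment_seq w 0 r m
  else rational_seq w n (pred k) (node_prod INR r) m.

Lemma basis_seq_low w n k r m : (m < r)%nat -> basis_seq w n k r m = 0.
Proof.
intros Hm; unfold basis_seq, moment_seq, rational_seq, Rdiv; simpl.
rewrite (node_prod_eq_0 INR r m) by auto.
destruct (Nat.eqb n 0); ring.
Qed.

Lemma basis_seq_diag w n k r : w r <> 0 -> basis_seq w n k r r <> 0.
Proof.
intros Hw; unfold basis_seq, moment_seq, rational_seq; simpl.
assert (N : node_prod INR r (INR r) <> 0).
{ apply node_prod_neq_0; intros t Ht E; apply INR_eq in E; lia. }
destruct (Nat.eqb n 0); repeat apply Rmult_integral_contrapositive_currified; auto;
  apply Rinv_neq_0_compat, Rmult_integral_contrapositive_currified; apply half_prod_neq_0.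
Qed.

Lemma basis_in_moments w n k (V : (nat -> R) -> Prop) : subspace V ->
  (forall i j, (i <= n)%nat -> (j < k)%nat -> V (moment_seq w i j)) ->
  forall r, (r < class_dim n k)%nat -> V (basis_seq w n k r).
Proof.
intros HV H r Hr; destruct k as [|K]; simpl in Hr; [lia|].
unfold basis_seq; destruct (Nat.eqb_spec n 0) as [->|]; [apply H; lia|].
apply rational_in_span; auto; [lia|intros; apply H; lia|].
apply poly_le with (0 + r)%nat; [lia|].
apply poly_ext with (fun x => 1 * node_prod INR r x); [intros; ring|].
apply (poly_node_prod _ (fun _ => 1)), poly_const.
Qed.

Lemma moments_in_basis w n k (V : (nat -> R) -> Prop) : subspace V ->
  (forall r, (r < class_dim n k)%nat -> V (basis_seq w n k r)) ->
  forall i j, (i <= n)%nat -> (j < k)%nat -> V (moment_seq w i j).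
Proof.
intros HV H i j Hi Hj; destruct k as [|K]; simpl in *; [lia|].
unfold basis_seq in H; destruct (Nat.eqb_spec n 0) as [->|].
- replace i with O by lia; apply H; auto.
- destruct (moment_seq_rational w n K i j) as (p & P & E); auto; [lia|].
  apply (subspace_ext V HV (rational_seq w n K p)); auto.
  set (v := fun m => w m / (node_prod half K (INR m) * node_prod half (n + K) (INR m))).
  apply (subspace_ext V HV (fun m => v m * p (INR m))).
  + intros m; unfold v, rational_seq, Rdiv; ring.
  + apply (poly_in_span V INR v INR (n + 2 * K)); auto.
    intros r Hr; apply (subspace_ext V HV (rational_seq w n K (node_prod INR r))).
    * intros m; unfold v, rational_seq, Rdiv; ring.
    * apply H; lia.
Qed.

(** * Trigonometric moments *)

Lemma continuous_pow (f : R -> R) n x : continuous f x -> continuous (fun t => f t ^ n) x.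
Proof.
intros C; induction n as [|n IH]; simpl; [apply continuous_const|].
apply (continuous_mult (K := R_AbsRing) f (fun t => f t ^ n)); auto.
Qed.

Lemma continuous_Rmult (f g : R -> R) x :
  continuous f x -> continuous g x -> continuous (fun t => f t * g t) x.
Proof. intros; apply (continuous_mult (K := R_AbsRing) f g); auto. Qed.

Definition moment_fun (p q : nat) (th : R) : R := (sin th ^ 2) ^ p * cos th ^ q.

Definition moment (p q : nat) : R := RInt (moment_fun p q) (- (PI / 2)) (PI / 2).

Lemma moment_fun_continuous p q x : continuous (moment_fun p q) x.
Proof.
apply continuous_Rmult; apply continuous_pow;
  [apply continuous_pow; apply continuous_sin|apply continuous_cos].
Qed.

Lemma is_RInt_moment p q : is_RInt (moment_fun p q) (- (PI / 2)) (PI / 2) (moment p q).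
Proof.
apply (RInt_correct (V := R_CompleteNormedModule)), (ex_RInt_continuous (V := R_CompleteNormedModule)).
intros; apply moment_fun_continuous.
Qed.

Lemma sin2_bounds th : 0 <= sin th ^ 2 <= 1.
Proof. pose proof (sin2_cos2 th) as E; unfold Rsqr in E; nra. Qed.

Lemma pow_bounds x n : 0 <= x <= 1 -> 0 <= x ^ n <= 1.
Proof.
intros Hx; split; [apply pow_le; lra|].
rewrite <- (pow1 n); apply pow_incr; lra.
Qed.

Lemma moment_fun_bounds p q th : - (PI / 2) <= th <= PI / 2 -> 0 <= moment_fun p q th <= 1.
Proof.
intros Hth; unfold moment_fun.
pose proof (pow_bounds _ p (sin2_bounds th)).
assert (C : 0 <= cos th <= 1) by (split; [apply cos_ge_0; lra|apply COS_bound]).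
pose proof (pow_bounds _ q C); nra.
Qed.

Lemma moment_bounds p q : 0 <= moment p q <= PI.
Proof.
pose proof PI_RGT_0.
assert (E : ex_RInt (moment_fun p q) (- (PI / 2)) (PI / 2)) by (eexists; apply is_RInt_moment).
split.
- apply RInt_ge_0; auto; [lra|]; intros; apply moment_fun_bounds; lra.
- replace PI with (RInt (fun _ => 1) (- (PI / 2)) (PI / 2)).
  + apply RInt_le; auto; [lra|apply ex_RInt_const|].
    intros; apply moment_fun_bounds; lra.
  + rewrite RInt_const; unfold scal; simpl; unfold mult; simpl; field.
Qed.

Lemma moment_plus2 p q : moment p (q + 2) = moment p q - moment (S p) q.
Proof.
apply (is_RInt_unique (V := R_CompleteNormedModule)).
apply (is_RInt_ext (fun th => minus (moment_fun p q th) (moment_fun (S p) q th))).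
- intros th _; unfold moment_fun, minus, plus, opp; simpl.
  pose proof (sin2_cos2 th) as E; unfold Rsqr in E.
  rewrite pow_add; simpl; rewrite !Rmult_1_r.
  replace (cos th * cos th) with (1 - sin th * sin th) by lra; ring.
- apply (is_RInt_minus (V := R_NormedModule)); apply is_RInt_moment.
Qed.

(** Integration of the derivative of sin ^ (2 p + 1) * cos ^ (q + 1). *)
Lemma moment_shift p q :
  (2 * INR p + 1) * moment p (q + 2) = (INR q + 1) * moment (S p) q.
Proof.
pose proof PI_RGT_0.
set (dF := fun th => (2 * INR p + 1) * moment_fun p (q + 2) th +
                     - (INR q + 1) * moment_fun (S p) q th).
assert (I1 : is_RInt dF (- (PI / 2)) (PI / 2)
  ((2 * INR p + 1) * moment p (q + 2) + - (INR q + 1) * moment (S p) q)).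
{ apply (is_RInt_plus (V := R_NormedModule));
    apply (is_RInt_scal (V := R_NormedModule)); apply is_RInt_moment. }
assert (I2 : is_RInt dF (- (PI / 2)) (PI / 2) 0).
{ set (F := fun th => sin th ^ (2 * p + 1) * cos th ^ (q + 1)).
  replace 0 with (minus (F (PI / 2)) (F (- (PI / 2)))).
  - apply (is_RInt_derive (V := R_CompleteNormedModule)).
    + intros th _; unfold F, dF, moment_fun; auto_derive; auto.
      replace (p + (p + 0) + 1)%nat with (S (2 * p)) by lia.
      rewrite Nat.add_1_r, !S_INR, mult_INR, <- !pow_mult; cbn [Nat.pred].
      replace (2 * S p)%nat with (S (S (2 * p))) by lia.
      rewrite pow_add; simpl (INR 2); simpl (_ ^ S _); ring.
    + intros th _; apply (continuous_plus (V := R_NormedModule));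
        apply continuous_Rmult; try apply continuous_const; apply moment_fun_continuous.
  - unfold F, minus, plus, opp; simpl.
    rewrite cos_neg, cos_PI2, !Nat.add_1_r; simpl (0 ^ _); real_eq; ring. }
apply (is_RInt_unique (V := R_CompleteNormedModule)) in I1.
apply (is_RInt_unique (V := R_CompleteNormedModule)) in I2.
rewrite I1 in I2; lra.
Qed.

Lemma moment_pos p q : 0 < moment p q.
Proof.
pose proof PI_RGT_0; induction p as [|p IH].
- apply RInt_gt_0; [lra| |intros; apply moment_fun_continuous].
  intros x Hx; unfold moment_fun; simpl; rewrite Rmult_1_l.
  apply pow_lt, cos_gt_0; lra.
- pose proof (moment_shift p q) as E; rewrite moment_plus2 in E.
  pose proof (pos_INR p); pose proof (pos_INR q); nra.
Qed.

(** * The power series of (1 - x) ^ (-1/2) *)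

(** The numbers (1/2) (3/2) ... (k - 1/2) / k!. *)
Fixpoint binv (k : nat) : R :=
  match k with
  | O => 1
  | S k => binv k * (half k / INR (S k))
  end.

Lemma binv_S k : binv (S k) * INR (S k) = binv k * half k.
Proof.
change (binv k * (half k / INR (S k)) * INR (S k) = binv k * half k).
field; apply not_0_INR; lia.
Qed.

Lemma half_pos k : 0 < half k.
Proof. unfold half; pose proof (pos_INR k); lra. Qed.

Lemma binv_bounds k : 0 < binv k <= 1.
Proof.
induction k as [|k IH]; [simpl; lra|].
pose proof (binv_S k) as E; rewrite S_INR in E; pose proof (pos_INR k).
pose proof (half_pos k); unfold half in *; nra.
Qed.

Lemma CV_radius_ge (a : nat -> R) r : (exists M, forall n, Rabs (a n * r ^ n) <= M) ->
  Rbar_le r (CV_radius a).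
Proof. intros H; apply (CV_radius_bounded a); auto. Qed.

Lemma binv_radius : Rbar_le 1 (CV_radius binv).
Proof.
apply CV_radius_ge; exists 1; intros n; rewrite pow1, Rmult_1_r.
pose proof (binv_bounds n); apply Rabs_le; lra.
Qed.

Lemma binv_inside x : 0 <= x < 1 -> Rbar_lt (Rabs x) (CV_radius binv).
Proof.
intros Hx; apply Rbar_lt_le_trans with 1; [|apply binv_radius].
simpl; rewrite Rabs_pos_eq; lra.
Qed.

(** Comparison of coefficients. *)
Lemma binv_ode x : 0 <= x < 1 ->
  (1 - x) * PSeries (PS_derive binv) x = / 2 * PSeries binv x.
Proof.
intros Hx.
assert (E : ex_pseries (PS_derive binv) x) by (apply ex_pseries_derive, binv_inside, Hx).
replace ((1 - x) * PSeries (PS_derive binv) x) with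
  (PSeries (PS_derive binv) x - x * PSeries (PS_derive binv) x) by ring.
rewrite <- PSeries_incr_1, <- PSeries_minus; auto; [|apply ex_pseries_incr_1; auto].
rewrite <- PSeries_scal; apply PSeries_ext; intros [|n].
- change (INR 1 * binv 1 + - 0 = / 2 * binv 0).
  rewrite (Rmult_comm (INR 1)), binv_S; unfold half; simpl; field.
- change (INR (S (S n)) * binv (S (S n)) + - (INR (S n) * binv (S n)) = / 2 * binv (S n)).
  rewrite (Rmult_comm (INR (S (S n)))), binv_S; unfold half; field.
Qed.

(** By the differential equation the product with sqrt (1 - x) is constant. *)
Lemma binv_PSeries x : 0 <= x < 1 -> PSeries binv x = / sqrt (1 - x).
Proof.
intros Hx.
assert (G : forall t, 0 <= t <= x -> is_derive (fun t => PSeries binv t * sqrt (1 - t)) t 0).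
{ intros t Ht.
  assert (Ps : 0 < sqrt (1 - t)) by (apply sqrt_lt_R0; lra).
  replace 0 with (PSeries (PS_derive binv) t * sqrt (1 - t) +
    PSeries binv t * (- (1) / (2 * sqrt (1 - t)))).
  - apply (is_derive_mult (PSeries binv) (fun t => sqrt (1 - t)) t).
    + apply is_derive_PSeries, binv_inside; lra.
    + auto_derive; [lra|reflexivity].
    + intros; apply Rmult_comm.
  - pose proof (binv_ode t ltac:(lra)) as E.
    replace (PSeries binv t) with (2 * ((1 - t) * PSeries (PS_derive binv) t)) by lra.
    rewrite <- (sqrt_sqrt (1 - t)) at 2 by lra; field; lra. }
assert (E : PSeries binv x * sqrt (1 - x) = 1).
{ destruct (Req_dec x 0) as [->|].
  - rewrite PSeries_0, Rminus_0_r, sqrt_1; simpl; ring.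
  - rewrite <- (eq_is_derive (V := R_NormedModule) _ 0 x G) by lra.
    rewrite PSeries_0, Rminus_0_r, sqrt_1; simpl; ring. }
assert (Ps : 0 < sqrt (1 - x)) by (apply sqrt_lt_R0; lra).
apply Rmult_eq_reg_r with (sqrt (1 - x)); [|lra].
rewrite E; field; lra.
Qed.

Definition binv_partial (N : nat) (x : R) : R := sum_n (fun k => binv k * x ^ k) N.

(** All coefficients are positive, so the remainder at the right end point bounds
    the remainder on the whole interval. *)
Lemma binv_tail_monotone N x y : 0 <= x <= y -> y < 1 ->
  0 <= PSeries binv x - binv_partial N x <= PSeries binv y - binv_partial N y.
Proof.
intros Hx Hy.
assert (T : forall z, 0 <= z < 1 -> PSeries binv z - binv_partial N z =
  z ^ S N * PSeries (PS_decr_n binv (S N)) z /\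
  ex_pseries (PS_decr_n binv (S N)) z).
{ intros z Hz; assert (Ez : ex_pseries binv z) by (apply CV_radius_inside, binv_inside, Hz).
  split.
  - rewrite (PSeries_decr_n binv N z Ez); unfold binv_partial; rewrite sum_n_Reals; ring.
  - apply ex_pseries_decr_n; auto.
    destruct (Req_dec z 0) as [->|Nz]; [left; reflexivity|right; exists (/ z)].
    unfold mult, one; simpl; field; auto. }
destruct (T x) as [-> Ex]; [lra|]; destruct (T y) as [-> Ey]; [lra|].
assert (P : forall z, 0 <= z -> forall n, 0 <= PS_decr_n binv (S N) n * z ^ n).
{ intros z Hz n; unfold PS_decr_n; pose proof (binv_bounds (S N + n)).
  pose proof (pow_le z n Hz); nra. }
assert (L : 0 <= PSeries (PS_decr_n binv (S N)) x <= PSeries (PS_decr_n binv (S N)) y).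
{ split.
  - unfold PSeries; rewrite <- (Rmult_0_l (Series (fun _ => 0))), <- Series_scal_l.
    apply ex_pseries_R in Ex; apply (Series_le _ _) with (2 := Ex).
    intros n; split; [lra|rewrite Rmult_0_l; apply P; lra].
  - apply ex_pseries_R in Ey; apply (Series_le _ _) with (2 := Ey).
    intros n; split; [apply P; lra|].
    unfold PS_decr_n; pose proof (binv_bounds (S N + n)).
    apply Rmult_le_compat_l; [lra|apply pow_incr; lra]. }
assert (0 <= x ^ S N <= y ^ S N) by (split; [apply pow_le; lra|apply pow_incr; lra]).
nra.
Qed.

Lemma is_RInt_sum_n_m (F : nat -> R -> R) (L : nat -> R) a b s s' :
  (forall k, is_RInt (F k) a b (L k)) ->
  is_RInt (fun t => sum_n_m (fun k => F k t) s s') a b (sum_n_m L s s').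
Proof.
intros H; destruct (le_lt_dec s s') as [Hs|Hs].
- induction s' as [|s' IH].
  + replace s with O by lia; rewrite sum_n_n.
    apply (is_RInt_ext (F O)); auto; intros; now rewrite sum_n_n.
  + destruct (Nat.eq_dec s (S s')) as [->|].
    * rewrite sum_n_n; apply (is_RInt_ext (F (S s'))); auto; intros; now rewrite sum_n_n.
    * rewrite sum_n_Sm by auto.
      apply (is_RInt_ext (fun t => plus (sum_n_m (fun k => F k t) s s') (F (S s') t))).
      -- intros; now rewrite sum_n_Sm.
      -- apply (is_RInt_plus (V := R_NormedModule)); auto; apply IH; lia.
- rewrite sum_n_m_zero by auto.
  apply (is_RInt_ext (fun _ => 0)); [intros; now rewrite sum_n_m_zero|].
  pose proof (is_RInt_const (V := R_NormedModule) a b 0) as E0.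
  rewrite (scal_zero_r (V := R_NormedModule)) in E0; exact E0.
Qed.

(** For p = q = 0, the integrand of the complete elliptic integral of the first
    kind. *)
Definition elliptic_fun (p q : nat) (kap th : R) : R :=
  moment_fun p q th * / sqrt (1 - kap * sin th ^ 2).

Lemma elliptic_arg_bounds kap th : 0 <= kap < 1 -> 0 <= kap * sin th ^ 2 <= kap.
Proof. intros Hk; pose proof (sin2_bounds th); nra. Qed.

Lemma elliptic_fun_continuous p q kap th : 0 <= kap < 1 ->
  continuous (elliptic_fun p q kap) th.
Proof.
intros Hk; apply continuous_Rmult; [apply moment_fun_continuous|].
apply (ex_derive_continuous (fun th => / sqrt (1 - kap * sin th ^ 2)) th); auto_derive.
pose proof (elliptic_arg_bounds kap th Hk) as E; simpl in E.
split; [lra|split; auto].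
apply Rgt_not_eq, sqrt_lt_R0; lra.
Qed.

(** Term by term integration: the remainder of the expansion of the inverse
    square root is at most its value at sin th ^ 2 = 1, uniformly in th. *)
Lemma elliptic_series p q kap : 0 <= kap < 1 ->
  is_pseries (fun k => binv k * moment (p + k) q) kap
    (RInt (elliptic_fun p q kap) (- (PI / 2)) (PI / 2)).
Proof.
intros Hk; pose proof PI_RGT_0.
set (I := RInt (elliptic_fun p q kap) (- (PI / 2)) (PI / 2)).
set (rem := fun N => PSeries binv kap - binv_partial N kap).
assert (HI : is_RInt (elliptic_fun p q kap) (- (PI / 2)) (PI / 2) I).
{ apply (RInt_correct (V := R_CompleteNormedModule)), (ex_RInt_continuous (V := R_CompleteNormedModule)).
  intros; apply elliptic_fun_continuous; auto. }
assert (HS : forall N, is_RInt (fun th => moment_fun p q th * binv_partial N (kap * sin th ^ 2))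
  (- (PI / 2)) (PI / 2) (sum_n (fun k => binv k * moment (p + k) q * kap ^ k) N)).
{ intros N.
  apply (is_RInt_ext (fun th => sum_n (fun k => scal (binv k * kap ^ k) (moment_fun (p + k) q th)) N)).
  - intros th _; unfold binv_partial.
    rewrite <- (sum_n_mult_l (K := R_Ring)); apply sum_n_ext; intros k.
    unfold scal, mult; simpl; unfold mult; simpl; unfold moment_fun.
    rewrite pow_add, Rpow_mult_distr; simpl; real_eq; ring.
  - rewrite (sum_n_ext _ (fun k => scal (binv k * kap ^ k) (moment (p + k) q))).
    + apply is_RInt_sum_n_m; intros k; apply (is_RInt_scal (V := R_NormedModule)), is_RInt_moment.
    + intros k; unfold scal; simpl; unfold mult; simpl; ring. }
apply is_pseries_R; change (is_lim_seq (sum_n (fun k => binv k * moment (p + k) q * kap ^ k)) I).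
assert (L : is_lim_seq rem 0).
{ replace (Finite 0) with (Rbar_minus (PSeries binv kap) (PSeries binv kap))
    by (simpl; f_equal; ring).
  apply is_lim_seq_minus'; [apply is_lim_seq_const|].
  assert (Ek : ex_pseries binv kap) by (apply CV_radius_inside, binv_inside, Hk).
  apply PSeries_correct, is_pseries_R in Ek; exact Ek. }
apply is_lim_seq_le_le with (fun N => I - PI * rem N) (fun _ => I).
- intros N.
  assert (D : is_RInt (fun th => minus (elliptic_fun p q kap th)
    (moment_fun p q th * binv_partial N (kap * sin th ^ 2))) (- (PI / 2)) (PI / 2)
    (minus I (sum_n (fun k => binv k * moment (p + k) q * kap ^ k) N))).
  { apply (is_RInt_minus (V := R_NormedModule)); auto. }
  assert (B : forall th, - (PI / 2) < th < PI / 2 -> 0 <= minus (elliptic_fun p q kap th)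
    (moment_fun p q th * binv_partial N (kap * sin th ^ 2)) <= rem N).
  { intros th Hth; unfold elliptic_fun, minus, plus, opp; simpl.
    pose proof (elliptic_arg_bounds kap th Hk) as A; simpl in A.
    rewrite <- binv_PSeries by lra.
    destruct (binv_tail_monotone N (kap * (sin th * (sin th * 1))) kap) as [B1 B2]; [lra|lra|].
    pose proof (moment_fun_bounds p q th ltac:(lra)); fold (rem N) in B2; nra. }
  assert (Ec : is_RInt (fun _ => rem N) (- (PI / 2)) (PI / 2) (PI * rem N)).
  { replace (PI * rem N) with (scal (PI / 2 - - (PI / 2)) (rem N)).
    - apply (is_RInt_const (V := R_NormedModule)).
    - unfold scal; simpl; unfold mult; simpl; field. }
  assert (E0 : is_RInt (fun _ => 0) (- (PI / 2)) (PI / 2) 0).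
  { pose proof (is_RInt_const (V := R_NormedModule) (- (PI / 2)) (PI / 2) 0) as E0.
    rewrite (scal_zero_r (V := R_NormedModule)) in E0; exact E0. }
  assert (Hpi : - (PI / 2) <= PI / 2) by lra.
  assert (L1 := is_RInt_le _ _ _ _ _ _ Hpi E0 D (fun x Hx => proj1 (B x Hx))).
  assert (L2 := is_RInt_le _ _ _ _ _ _ Hpi D Ec (fun x Hx => proj2 (B x Hx))).
  set (SN := sum_n _ N) in L1, L2 |- *.
  change (0 <= I - SN) in L1; change (I - SN <= PI * rem N) in L2.
  change (I - PI * rem N <= SN <= I); lra.
- replace (Finite I) with (Rbar_minus I (PI * 0)) by (simpl; f_equal; ring).
  apply is_lim_seq_minus'; [apply is_lim_seq_const|].
  apply (is_lim_seq_scal_l rem PI 0 L).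
- apply is_lim_seq_const.
Qed.

(** * The coefficients of the moment series *)

Lemma binv_falling l m : (l <= m)%nat ->
  binv (m - l) * node_prod half l (INR m) = binv m * node_prod INR l (INR m).
Proof.
induction l as [|l IH]; intros Hl; simpl.
- now rewrite Nat.sub_0_r.
- rewrite <- !Rmult_assoc, <- IH by lia.
  replace (m - l)%nat with (S (m - S l)) by lia.
  pose proof (binv_S (m - S l)) as E.
  replace (half (m - S l)) with (INR m - half l) in E.
  + replace (INR (S (m - S l))) with (INR m - INR l) in E.
    * transitivity (binv (m - S l) * (INR m - half l) * node_prod half l (INR m)); [ring|].
      rewrite <- E; ring.
    * rewrite S_INR, minus_INR, S_INR by lia; ring.
  + unfold half; rewrite minus_INR, S_INR by lia; field.
Qed.

Fixpoint moment_factor (q j : nat) : R :=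
  match j with
  | O => 1
  | S j => moment_factor q j * ((INR (q + 2 * j) + 1) / 2)
  end.

Lemma moment_factor_pos q j : 0 < moment_factor q j.
Proof.
induction j as [|j IH]; simpl; [lra|].
pose proof (pos_INR (q + (j + (j + 0)))).
apply Rmult_lt_0_compat; auto; lra.
Qed.

Lemma moment_diagonal q j m : (j <= m)%nat ->
  moment (m - j) (q + 2 * j) * node_prod half j (INR m) = moment_factor q j * moment m q.
Proof.
induction j as [|j IH]; intros Hj; simpl node_prod; simpl moment_factor.
- rewrite Nat.sub_0_r, Nat.add_0_r; ring.
- pose proof (moment_shift (m - S j) (q + 2 * j)) as E.
  replace (S (m - S j)) with (m - j)%nat in E by lia.
  replace (q + 2 * j + 2)%nat with (q + 2 * S j)%nat in E by lia.
  rewrite minus_INR, S_INR in E by lia.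
  transitivity ((2 * (INR m - (INR j + 1)) + 1) * moment (m - S j) (q + 2 * S j) / 2 *
    node_prod half j (INR m)); [unfold half; field|].
  rewrite E.
  transitivity ((INR (q + 2 * j) + 1) / 2 * (moment (m - j) (q + 2 * j) * node_prod half j (INR m)));
    [field|].
  rewrite IH by lia; simpl; ring.
Qed.

Definition weight (q m : nat) : R := binv m * (/ 2) ^ m * moment m q.

Lemma weight_neq_0 q m : weight q m <> 0.
Proof.
unfold weight; pose proof (binv_bounds m); pose proof (moment_pos m q).
pose proof (pow_lt (/ 2) m ltac:(lra)).
apply Rgt_not_eq; repeat apply Rmult_lt_0_compat; lra.
Qed.

(** The expansion of the integral of u ^ i * y ^ (s + 2 j), u = 1 - cos x, starts
    at h ^ (i + j). Relative to i = j = 0 its coefficients are a rational function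
    of m: binv contributes the first denominator and the moments the second. *)
Lemma moment_seq_series q i j m :
  PS_incr_n (fun k => binv k * (/ 2) ^ k * moment (i + k) (q + 2 * j)) (i + j) m =
  2 ^ (i + j) * moment_factor q j * moment_seq (weight q) i j m.
Proof.
rewrite PS_incr_n_simplify; unfold moment_seq.
destruct (le_lt_dec (i + j) m) as [Hm|Hm].
- replace (i + (m - (i + j)))%nat with (m - j)%nat by lia.
  pose proof (half_prod_neq_0 j m); pose proof (half_prod_neq_0 (i + j) m).
  pose proof (binv_falling (i + j) m Hm) as E1.
  pose proof (moment_diagonal q j m ltac:(lia)) as E2.
  apply Rmult_eq_reg_r with (node_prod half j (INR m) * node_prod half (i + j) (INR m));
    [|apply Rmult_integral_contrapositive_currified; auto].
  transitivity ((binv (m - (i + j)) * node_prod half (i + j) (INR m)) * (/ 2) ^ (m - (i + j)) *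
    (moment (m - j) (q + 2 * j) * node_prod half j (INR m))); [ring|].
  rewrite E1, E2; unfold weight.
  replace ((/ 2) ^ (m - (i + j))) with (2 ^ (i + j) * (/ 2) ^ m); [field; auto|].
  replace ((/ 2) ^ m) with ((/ 2) ^ (i + j) * (/ 2) ^ (m - (i + j)))
    by (rewrite <- pow_add; f_equal; lia).
  rewrite <- Rmult_assoc, <- Rpow_mult_distr.
  replace (2 * / 2) with 1 by field; rewrite pow1; ring.
- rewrite (node_prod_eq_0 INR (i + j) m) by auto.
  change (0 = 2 ^ (i + j) * moment_factor q j *
    (weight q m * (0 / (node_prod half j (INR m) * node_prod half (i + j) (INR m))))).
  unfold Rdiv; ring.
Qed.

(** Implies radius of convergence at least 2, and is visibly a linear condition. *)
Definition tame (a : nat -> R) : Prop := exists M, forall n, Rabs (a n * 2 ^ n) <= M.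

Lemma tame_subspace : subspace tame.
Proof.
split.
- exists 0; intros; rewrite Rmult_0_l, Rabs_R0; lra.
- intros f g c [A HA] [B HB]; exists (A + Rabs c * B); intros n.
  replace ((f n + c * g n) * 2 ^ n) with (f n * 2 ^ n + c * (g n * 2 ^ n)) by ring.
  eapply Rle_trans; [apply Rabs_triang|]; rewrite (Rabs_mult c).
  apply Rplus_le_compat; auto; apply Rmult_le_compat_l; auto; apply Rabs_pos.
- intros f g E [M H]; exists M; intros; rewrite <- E; auto.
Qed.

Lemma tame_ex_pseries a h : tame a -> 0 < h < 2 -> ex_pseries a h.
Proof.
intros T Hh; apply CV_radius_inside.
apply Rbar_lt_le_trans with 2; [simpl; rewrite Rabs_pos_eq; lra|].
apply CV_radius_ge; auto.
Qed.

Lemma moment_seq_tame q i j : tame (moment_seq (weight q) i j).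
Proof.
set (c := 2 ^ (i + j) * moment_factor q j).
assert (Hc : 0 < c).
{ apply Rmult_lt_0_compat; [apply pow_lt; lra|apply moment_factor_pos]. }
apply (subspace_ext _ tame_subspace (fun m => / c *
  PS_incr_n (fun k => binv k * (/ 2) ^ k * moment (i + k) (q + 2 * j)) (i + j) m)).
{ intros m; rewrite moment_seq_series; fold c; field; lra. }
apply subspace_scal; [apply tame_subspace|].
exists (2 ^ (i + j) * PI); intros n; rewrite PS_incr_n_simplify.
destruct (le_lt_dec (i + j) n) as [Hn|Hn].
- set (k := (n - (i + j))%nat).
  replace (2 ^ n) with (2 ^ (i + j) * 2 ^ k) by (rewrite <- pow_add; f_equal; unfold k; lia).
  replace (binv k * (/ 2) ^ k * moment (i + k) (q + 2 * j) * (2 ^ (i + j) * 2 ^ k)) with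
    (2 ^ (i + j) * (binv k * moment (i + k) (q + 2 * j)) * ((/ 2) ^ k * 2 ^ k)) by ring.
  rewrite <- Rpow_mult_distr; replace (/ 2 * 2) with 1 by field; rewrite pow1, Rmult_1_r.
  pose proof (binv_bounds k); pose proof (moment_bounds (i + k) (q + 2 * j)).
  pose proof (pow_lt 2 (i + j) ltac:(lra)).
  assert (0 <= binv k * moment (i + k) (q + 2 * j) <= PI) by nra.
  rewrite Rabs_pos_eq; nra.
- change (Rabs (0 * 2 ^ n) <= 2 ^ (i + j) * PI).
  rewrite Rmult_0_l, Rabs_R0; pose proof PI_RGT_0.
  pose proof (pow_lt 2 (i + j) ltac:(lra)); nra.
Qed.

(** * The integrals along the level curves *)

Definition level_int (p : R -> R) (s : nat) (h : R) : R :=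
  RInt (fun t => p (cos t) * yabs h t ^ s) (- xmax h) (xmax h).

Lemma yabs_continuous h t : continuous (yabs h) t.
Proof.
apply (continuous_comp (fun t => 2 * (h - 1 + cos t)) sqrt); [|apply continuous_sqrt].
apply continuous_Rmult; [apply continuous_const|].
apply (continuous_plus (V := R_NormedModule)); [apply continuous_const|apply continuous_cos].
Qed.

Lemma is_RInt_level p s h : (forall x, continuous p x) ->
  is_RInt (fun t => p (cos t) * yabs h t ^ s) (- xmax h) (xmax h) (level_int p s h).
Proof.
intros Hp.
apply (RInt_correct (V := R_CompleteNormedModule)), (ex_RInt_continuous (V := R_CompleteNormedModule)).
intros t _; apply continuous_Rmult.
- apply (continuous_comp cos p); auto; apply continuous_cos.
- apply continuous_pow, yabs_continuous.
Qed.

(** The substitution sin (t / 2) = sqrt (h / 2) * sin th maps the arc to the fixed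
    interval from - PI / 2 to PI / 2 and gives 1 - cos t = h * sin th ^ 2 and
    yabs h t = sqrt (2 * h) * cos th. *)
Lemma level_int_elliptic i s h : 0 < h < 2 ->
  level_int (fun c => (1 - c) ^ i) s h =
  sqrt (2 * h) ^ (s + 1) * h ^ i *
  RInt (elliptic_fun i (s + 1) (h / 2)) (- (PI / 2)) (PI / 2).
Proof.
intros Hh; pose proof PI_RGT_0.
set (k := sqrt (h / 2)).
assert (Hk2 : k * k = h / 2) by (apply sqrt_sqrt; lra).
assert (Hk : 0 < k < 1).
{ split; [apply sqrt_lt_R0; lra|].
  rewrite <- sqrt_1; apply sqrt_lt_1; lra. }
assert (Ks : sqrt (2 * h) = 2 * k).
{ apply sqrt_lem_1; nra. }
assert (Hks : forall th, -1 < k * sin th < 1).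
{ intros th; pose proof (SIN_bound th); nra. }
set (g := fun th => 2 * asin (k * sin th)).
set (dg := fun th => 2 * (k * cos th * / sqrt (1 - (k * sin th) ^ 2))).
assert (Cg : forall th, cos (g th) = 1 - h * sin th ^ 2).
{ intros th; unfold g; rewrite cos_2a_sin, sin_asin by (pose proof (Hks th); lra).
  replace h with (2 * (k * k)) by lra; ring. }
assert (Xm : g (PI / 2) = xmax h).
{ unfold xmax; replace (1 - h) with (cos (g (PI / 2))) by (rewrite Cg, sin_PI2; ring).
  rewrite acos_cos; auto; unfold g; rewrite sin_PI2, Rmult_1_r.
  pose proof (asin_bound k); split; [|lra].
  destruct (Rle_lt_dec 0 (asin k)) as [|N]; [lra|].
  pose proof (sin_lt_0_var (asin k) ltac:(lra) N); rewrite sin_asin in *; lra. }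
assert (Xm' : g (- (PI / 2)) = - xmax h).
{ rewrite <- Xm; unfold g; rewrite sin_neg, <- Ropp_mult_distr_r, asin_opp; ring. }
unfold level_int; rewrite <- Xm', <- Xm.
rewrite <- (RInt_comp (V := R_CompleteNormedModule)
  (fun t => (1 - cos t) ^ i * yabs h t ^ s) g dg).
- rewrite <- (RInt_scal (V := R_CompleteNormedModule) (elliptic_fun i (s + 1) (h / 2))).
  2:{ apply (ex_RInt_continuous (V := R_CompleteNormedModule)).
      intros; apply elliptic_fun_continuous; lra. }
  apply RInt_ext; intros th Hth; rewrite Rmin_left, Rmax_right in Hth by lra.
  assert (C : 0 <= cos th) by (apply cos_ge_0; lra).
  assert (Y : yabs h (g th) = 2 * k * cos th).
  { unfold yabs; rewrite Cg; apply sqrt_lem_1.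
    - pose proof (sin2_bounds th); nra.
    - nra.
    - pose proof (sin2_cos2 th) as E; unfold Rsqr in E.
      replace (2 * k * cos th * (2 * k * cos th)) with (4 * (k * k) * (cos th * cos th)) by ring.
      rewrite Hk2; replace (cos th * cos th) with (1 - sin th * sin th) by lra; field. }
  rewrite Y, Cg, Ks; unfold dg, elliptic_fun, moment_fun.
  unfold scal; simpl; unfold mult; simpl.
  replace (k * sin th * (k * sin th * 1)) with (h / 2 * (sin th * (sin th * 1)))
    by (rewrite <- Hk2; ring).
  replace (1 - (1 - h * (sin th * (sin th * 1)))) with (h * (sin th * (sin th * 1))) by ring.
  rewrite !Nat.add_1_r, !Rpow_mult_distr; simpl; ring.
- intros th _; apply continuous_Rmult; apply continuous_pow; [|apply yabs_continuous].
  apply (continuous_minus (V := R_NormedModule)); [apply continuous_const|apply continuous_cos].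
- intros th _; split.
  + unfold g, dg.
    apply (is_derive_scal (fun th => asin (k * sin th)) th 2).
    apply (is_derive_comp asin (fun th => k * sin th)).
    * pose proof (Hks th) as B.
      replace (/ sqrt (1 - (k * sin th) ^ 2)) with (1 / sqrt (1 - (k * sin th)²))
        by (unfold Rsqr, Rdiv; simpl; rewrite Rmult_1_l, Rmult_1_r; reflexivity).
      rewrite <- (derive_pt_asin (k * sin th) B).
      apply is_derive_Reals, derive_pt_eq_1 with (derivable_pt_asin (k * sin th) B); auto.
    * auto_derive; auto; ring.
  + apply (ex_derive_continuous dg th); unfold dg; auto_derive.
    pose proof (elliptic_arg_bounds (h / 2) th ltac:(lra)) as E.
    assert (P : 0 < 1 - k * sin th * (k * sin th * 1)).
    { replace (k * sin th * (k * sin th * 1)) with (k * k * sin th ^ 2) by ring.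
      rewrite Hk2; lra. }
    split; [exact P|split; auto; apply Rgt_not_eq, sqrt_lt_R0, P].
Qed.

Lemma level_int_series s0 i j : exists c, 0 < c /\ forall h, 0 < h < 2 ->
  level_int (fun c => (1 - c) ^ i) (s0 + 2 * j) h =
  c * (Rpower h (INR (s0 + 1) / 2) * PSeries (moment_seq (weight (s0 + 1)) i j) h).
Proof.
set (K := 2 ^ (i + j) * moment_factor (s0 + 1) j).
assert (HK : 0 < K).
{ apply Rmult_lt_0_compat; [apply pow_lt; lra|apply moment_factor_pos]. }
assert (H2 : 0 < sqrt 2) by (apply sqrt_lt_R0; lra).
exists (sqrt 2 ^ (s0 + 1) * 2 ^ j * K); split.
{ pose proof (pow_lt 2 j ltac:(lra)); pose proof (pow_lt (sqrt 2) (s0 + 1) H2).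
  apply Rmult_lt_0_compat; auto; apply Rmult_lt_0_compat; auto. }
intros h Hh; rewrite level_int_elliptic by auto.
replace (s0 + 2 * j + 1)%nat with (s0 + 1 + 2 * j)%nat by lia.
rewrite <- (is_pseries_unique _ _ _ (elliptic_series i (s0 + 1 + 2 * j) (h / 2) ltac:(lra))).
assert (E : h ^ (i + j) * PSeries (fun k => binv k * moment (i + k) (s0 + 1 + 2 * j)) (h / 2) =
  K * PSeries (moment_seq (weight (s0 + 1)) i j) h).
{ transitivity (h ^ (i + j) *
    PSeries (fun k => binv k * (/ 2) ^ k * moment (i + k) (s0 + 1 + 2 * j)) h).
  - f_equal; apply Series_ext; intros n; unfold Rdiv; rewrite Rpow_mult_distr; ring.
  - rewrite <- PSeries_incr_n, <- PSeries_scal; apply PSeries_ext; intros n.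
    rewrite moment_seq_series; reflexivity. }
replace (Rpower h (INR (s0 + 1) / 2)) with (sqrt h ^ (s0 + 1)).
- rewrite (pow_add (sqrt (2 * h))), (pow_mult (sqrt (2 * h)) 2), pow2_sqrt by lra.
  rewrite sqrt_mult, !Rpow_mult_distr by lra.
  transitivity (sqrt 2 ^ (s0 + 1) * 2 ^ j * sqrt h ^ (s0 + 1) *
    (h ^ (i + j) * PSeries (fun k => binv k * moment (i + k) (s0 + 1 + 2 * j)) (h / 2)));
    [rewrite (pow_add h); ring|].
  rewrite E; ring.
- rewrite <- Rpower_sqrt, <- Rpower_pow by (try apply exp_pos; lra).
  rewrite Rpower_mult; f_equal; field.
Qed.

Lemma is_RInt_odd (f : R -> R) X : (forall t, continuous f t) ->
  (forall t, f (- t) = - f t) -> is_RInt f (- X) X 0.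
Proof.
intros C O.
assert (Ex : forall a b, ex_RInt f a b)
  by (intros; apply (ex_RInt_continuous (V := R_CompleteNormedModule)); auto).
assert (E : RInt f (- X) X = 0).
{ pose proof (RInt_comp_lin (V := R_CompleteNormedModule) f (-1) 0 (- X) X (Ex _ _)) as E.
  rewrite (RInt_ext _ f) in E.
  - replace (-1 * - X + 0) with X in E by ring; replace (-1 * X + 0) with (- X) in E by ring.
    rewrite <- (opp_RInt_swap (V := R_CompleteNormedModule) f (- X) X) in E by auto.
    unfold opp in E; simpl in E; lra.
  - intros t _; replace (-1 * t + 0) with (- t) by ring; rewrite O.
    unfold scal; simpl; unfold mult; simpl; ring. }
rewrite <- E; apply (RInt_correct (V := R_CompleteNormedModule)); auto.
Qed.

Definition pow_fun (i : nat) (c : R) : R := c ^ i.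

Lemma pow_fun_continuous i c : continuous (pow_fun i) c.
Proof. apply (continuous_pow (fun t => t)), continuous_id. Qed.

(** The sine part is odd in x while y is even, so it integrates to 0. *)
Lemma is_RInt_pert n s s' (a b : nat -> nat -> R) (sg h : R) :
  is_RInt (fun t => pert n s s' a b t (sg * yabs h t)) (- xmax h) (xmax h)
    (sum_n_m (fun k => sg ^ k * sum_n (fun i => a k i * level_int (pow_fun i) k h) n) s s').
Proof.
unfold pert; apply is_RInt_sum_n_m; intros k.
set (rest := fun t => match n with O => 0 | S m => sum_n (fun i => b k i * cos t ^ i) m end).
set (odd := fun t => sin t * rest t * (sg * yabs h t) ^ k).
apply (is_RInt_ext (fun t => plus
  (scal (sg ^ k) (sum_n (fun i => scal (a k i) (pow_fun i (cos t) * yabs h t ^ k)) n)) (odd t))).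
{ intros t _; unfold odd, rest, trig_poly, plus, scal; simpl; unfold mult; simpl.
  rewrite Rmult_plus_distr_r, Rpow_mult_distr; f_equal.
  transitivity (sg ^ k * yabs h t ^ k * sum_n (fun i => a k i * cos t ^ i) n); [|ring].
  rewrite Rmult_assoc; f_equal.
  rewrite <- (sum_n_mult_l (K := R_Ring)); apply sum_n_ext; intros i.
  unfold mult, pow_fun; simpl; real_eq; ring. }
rewrite <- (Rplus_0_r (sg ^ k * _)).
apply (is_RInt_plus (V := R_NormedModule)).
- apply (is_RInt_scal (V := R_NormedModule)), is_RInt_sum_n_m; intros i.
  apply (is_RInt_scal (V := R_NormedModule)), is_RInt_level, pow_fun_continuous.
- apply is_RInt_odd.
  + assert (Cr : forall t, continuous rest t).
    { intros t; unfold rest; destruct n as [|m]; [apply continuous_const|].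
      induction m as [|m IH].
      - apply (continuous_ext (fun t => b k O * cos t ^ 0)); [intros; now rewrite sum_O|].
        apply continuous_Rmult; [apply continuous_const|apply continuous_pow, continuous_cos].
      - apply (continuous_ext (fun t => plus (sum_n (fun i => b k i * cos t ^ i) m)
          (b k (S m) * cos t ^ S m))); [intros; now rewrite sum_Sn|].
        apply (continuous_plus (V := R_NormedModule)); auto.
        apply continuous_Rmult; [apply continuous_const|apply continuous_pow, continuous_cos]. }
    intros t; apply continuous_Rmult; [apply continuous_Rmult; auto; apply continuous_sin|].
    apply continuous_pow, continuous_Rmult; [apply continuous_const|apply yabs_continuous].
  + intros t; unfold odd, rest, yabs; rewrite sin_neg, cos_neg; ring.
Qed.

Lemma trig_poly_neg n a b x : trig_poly n a b (- x) = trig_poly n a (fun i => - b i) x.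
Proof.
unfold trig_poly; rewrite cos_neg, sin_neg; f_equal; destruct n as [|m]; [ring|].
rewrite <- Ropp_mult_distr_l, Ropp_mult_distr_r; f_equal.
rewrite <- (Rmult_1_l (sum_n _ m)), Ropp_mult_distr_l.
rewrite <- (sum_n_mult_l (K := R_Ring)); apply sum_n_ext; intros i.
unfold mult; simpl; real_eq; ring.
Qed.

Definition level_comb (n : nat) (e : nat -> R) (a : nat -> nat -> R) (s s' : nat) (h : R) : R :=
  sum_n_m (fun k => e k * sum_n (fun i => a k i * level_int (pow_fun i) k h) n) s s'.

(** On the lower arc y ^ s changes by (-1) ^ s and dx by -1. *)
Lemma melnikov_expansion n s1 s2 s3 (ap bp am bm : nat -> nat -> R) h :
  melnikov (pert n s1 s2 ap bp) (pert n s1 s3 am bm) h =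
  level_comb n (fun _ => 1) ap s1 s2 h + level_comb n (fun k => - (-1) ^ k) am s1 s3 h.
Proof.
unfold melnikov, line_int_dx, level_comb; f_equal.
- apply (is_RInt_unique (V := R_CompleteNormedModule)).
  apply (is_RInt_ext (fun t => pert n s1 s2 ap bp t (1 * yabs h t))).
  + intros t _; unfold upper_x, upper_y; rewrite Derive_id, Rmult_1_l, Rmult_1_r; reflexivity.
  + rewrite (sum_n_m_ext _ (fun k => 1 ^ k * sum_n (fun i => ap k i * level_int (pow_fun i) k h) n)).
    * apply is_RInt_pert.
    * intros k; now rewrite pow1.
- apply (is_RInt_unique (V := R_CompleteNormedModule)).
  apply (is_RInt_ext (fun t => opp (pert n s1 s3 am (fun k i => - bm k i) t (-1 * yabs h t)))).
  + intros t _; unfold lower_x, lower_y.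
    replace (Derive (fun t : R => - t) t) with (-1)
      by (symmetry; apply is_derive_unique; auto_derive; auto; ring).
    replace (- yabs h t) with (-1 * yabs h t) by ring.
    unfold pert; rewrite (sum_n_m_ext
      (fun k => trig_poly n (am k) (bm k) (- t) * (-1 * yabs h t) ^ k)
      (fun k => trig_poly n (am k) (fun i => - bm k i) t * (-1 * yabs h t) ^ k)).
    * set (I := sum_n_m _ _ _); change (- I = I * -1); ring.
    * intros k; now rewrite trig_poly_neg.
  + rewrite (sum_n_m_ext _ (fun k => mult (-1)
      ((-1) ^ k * sum_n (fun i => am k i * level_int (pow_fun i) k h) n))).
    * rewrite (sum_n_m_mult_l (K := R_Ring)).
      replace (mult (-1) _) with (opp (sum_n_m (fun k => (-1) ^ k *
        sum_n (fun i => am k i * level_int (pow_fun i) k h) n) s1 s3)).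
      -- apply (is_RInt_opp (V := R_NormedModule)), is_RInt_pert.
      -- set (I := sum_n_m _ _ _); change (- I = -1 * I); ring.
    * intros k; unfold mult; simpl; real_eq; ring.
Qed.

(** * The space of Melnikov functions *)

(** The series representations hold for 0 < h < 2 only, hence the second field. *)
Record function_space (V : (R -> R) -> Prop) : Prop := {
  function_space_subspace : subspace V;
  function_space_ext : forall f g, (forall h, 0 < h < 2 -> f h = g h) -> V f -> V g
}.

Lemma function_space_intro (V : (R -> R) -> Prop) :
  V (fun _ => 0) -> (forall f g c, V f -> V g -> V (fun x => f x + c * g x)) ->
  (forall f g, (forall h, 0 < h < 2 -> f h = g h) -> V f -> V g) -> function_space V.
Proof. intros S0 SL SE; split; [split|]; auto; intros f g E; apply SE; auto. Qed.

Lemma level_int_ext p q s h : (forall c, p c = q c) -> level_int p s h = level_int q s h.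
Proof. intros E; apply RInt_ext; intros; now rewrite E. Qed.

Lemma level_int_poly (V : (R -> R) -> Prop) (g : R -> R) n s : function_space V ->
  (forall c, continuous g c) ->
  (forall i, (i <= n)%nat -> V (level_int (fun c => g c ^ i) s)) ->
  forall p, polynomial n p -> V (level_int (fun c => p (g c)) s).
Proof.
intros [HV HE] Cg H p P.
set (T := fun p => (forall c, continuous p c) /\ V (level_int p s)).
assert (HT : subspace T).
{ split.
  - split; [intros; apply continuous_const|].
    apply (subspace_ext V HV (fun _ => 0)); [|apply (subspace_0 V HV)].
    intros h; symmetry; unfold level_int.
    rewrite (RInt_ext _ (fun _ => 0)) by (intros; apply Rmult_0_l).
    rewrite RInt_const; apply (scal_zero_r (V := R_NormedModule)).
  - intros f f' c [C I] [C' I']; split.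
    + intros x; apply (continuous_plus (V := R_NormedModule)); auto.
      apply continuous_Rmult; auto; apply continuous_const.
    + apply (subspace_ext V HV (fun h => level_int f s h + c * level_int f' s h));
        [|apply (subspace_lin V HV); auto].
      intros h; symmetry; apply (is_RInt_unique (V := R_CompleteNormedModule)).
      apply (is_RInt_ext (fun t => plus (f (cos t) * yabs h t ^ s)
        (scal c (f' (cos t) * yabs h t ^ s)))).
      * intros t _; unfold plus, scal; simpl; unfold mult; simpl; ring.
      * apply (is_RInt_plus (V := R_NormedModule)); [|apply (is_RInt_scal (V := R_NormedModule))];
          apply is_RInt_level; auto.
  - intros f f' E [C I]; split.
    + intros x; apply (continuous_ext f); auto.
    + apply (subspace_ext V HV (level_int f s)); auto; intros; apply level_int_ext; auto. }
apply (subspace_ext T HT (fun c => 1 * p (g c))); [intros; ring|].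
apply (poly_in_span T (fun _ => 0) (fun _ => 1) g n); auto.
intros r Hr; apply (subspace_ext T HT (fun c => g c ^ r)).
- intros c; rewrite Rmult_1_l; clear Hr; induction r as [|r IH]; simpl; auto.
  rewrite <- IH; ring.
- split; [intros; apply continuous_pow; auto|auto].
Qed.

Lemma poly_one_minus_pow i n : (i <= n)%nat -> polynomial n (fun c => (1 - c) ^ i).
Proof.
intros Hi; apply poly_le with i; auto; clear Hi.
induction i as [|i IH]; [exists 1; auto|].
apply poly_ext with (fun x => 0 + -1 * ((1 - x) ^ i * (x - 1))); [intros; simpl; ring|].
apply poly_lin; [apply poly_const|apply poly_mul_linear; auto].
Qed.

(** Number of exponents s1 + sg + 2 j in the range s1, ..., s1 + d. *)
Definition class_size (d sg : nat) : nat := ((d + 2 - sg) / 2)%nat.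

Lemma class_size_spec d sg j : (sg <= 1)%nat -> (j < class_size d sg <-> sg + 2 * j <= d)%nat.
Proof.
intros Hsg; unfold class_size.
pose proof (Nat.div_mod_eq (d + 2 - sg) 2).
pose proof (Nat.mod_upper_bound (d + 2 - sg) 2); lia.
Qed.

Lemma class_dim_total n d :
  (class_dim n (class_size d 0) + class_dim n (class_size d 1) =
   S (if Nat.eqb n 0 then d else if Nat.eqb d 0 then n else 2 * (n + d) - 1))%nat.
Proof.
assert (E : (class_size d 0 + class_size d 1 = d + 1 /\ 0 < class_size d 0 /\
  class_size d 1 <= d /\ (d <> 0 -> 0 < class_size d 1))%nat).
{ unfold class_size.
  pose proof (Nat.div_mod_eq (d + 2 - 0) 2); pose proof (Nat.mod_upper_bound (d + 2 - 0) 2).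
  pose proof (Nat.div_mod_eq (d + 2 - 1) 2); pose proof (Nat.mod_upper_bound (d + 2 - 1) 2).
  lia. }
destruct (class_size d 0) as [|K0]; [lia|]; destruct (class_size d 1) as [|K1];
  cbn [class_dim]; destruct (Nat.eqb_spec n 0); destruct (Nat.eqb_spec d 0); lia.
Qed.

(** A class sg, 0 or 1, collects the exponents s with s - s1 - sg even. *)
Definition class_seq (n s1 d sg r : nat) : nat -> R :=
  basis_seq (weight (s1 + sg + 1)) n (class_size d sg) r.

Definition class_fun (n s1 d sg r : nat) (h : R) : R :=
  Rpower h (INR (s1 + sg + 1) / 2) * PSeries (class_seq n s1 d sg r) h.

Lemma class_seq_tame n s1 d sg r : (r < class_dim n (class_size d sg))%nat ->
  tame (class_seq n s1 d sg r).
Proof.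
apply basis_in_moments; [apply tame_subspace|].
intros; apply moment_seq_tame.
Qed.

Lemma series_subspace (V : (R -> R) -> Prop) al : function_space V ->
  subspace (fun a => tame a /\ V (fun h => Rpower h al * PSeries a h)).
Proof.
intros [HV HE]; pose proof tame_subspace as HT; split.
- split; [apply (subspace_0 _ HT)|].
  apply (HE (fun _ => 0)); [|apply (subspace_0 V HV)].
  intros h _; replace (PSeries (fun _ => 0) h) with 0; [ring|].
  symmetry; apply PSeries_const_0.
- intros f g c [Tf Sf] [Tg Sg]; split; [apply (subspace_lin _ HT); auto|].
  apply (HE (fun h => Rpower h al * PSeries f h + c * (Rpower h al * PSeries g h)));
    [|apply (subspace_lin V HV); auto].
  intros h Hh.
  replace (PSeries (fun x => f x + c * g x) h) with (PSeries (PS_plus f (PS_scal c g)) h).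
  + rewrite PSeries_plus, PSeries_scal; [ring|apply tame_ex_pseries; auto|].
    apply ex_pseries_scal; [apply Rmult_comm|apply tame_ex_pseries; auto].
  + apply PSeries_ext; reflexivity.
- intros f g E [Tf Sf]; split; [apply (subspace_ext _ HT f); auto|].
  apply (subspace_ext V HV (fun h => Rpower h al * PSeries f h)); auto.
  intros h; f_equal; apply PSeries_ext; auto.
Qed.

(** Powers of cos and of 1 - cos span the same polynomials; the latter integrate
    to the series of the sequences moment_seq, which span the same space as the
    basis sequences. *)
Lemma level_span (V : (R -> R) -> Prop) n s1 d : function_space V ->
  (forall i s, (i <= n)%nat -> (s1 <= s <= s1 + d)%nat -> V (level_int (pow_fun i) s)) <->
  (forall sg r, (sg <= 1)%nat -> (r < class_dim n (class_size d sg))%nat ->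
    V (class_fun n s1 d sg r)).
Proof.
intros HF; pose proof HF as [HV HE]; split; intros H.
- intros sg r Hsg Hr.
  apply (basis_in_moments (weight (s1 + sg + 1)) n (class_size d sg)
    (fun a => tame a /\ V (fun h => Rpower h (INR (s1 + sg + 1) / 2) * PSeries a h)));
    auto using series_subspace.
  intros i j Hi Hj; split; [apply moment_seq_tame|].
  destruct (level_int_series (s1 + sg) i j) as (c & Hc & E).
  apply (HE (fun h => / c * level_int (fun c => (1 - c) ^ i) (s1 + sg + 2 * j) h)).
  + intros h Hh; rewrite E by auto; field; lra.
  + apply subspace_scal; auto.
    apply (level_int_poly V (fun c => c) n) with (p := fun c => (1 - c) ^ i); auto.
    * intros; apply continuous_id.
    * intros k Hk; apply H; auto.
      apply class_size_spec in Hj; auto; lia.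
    * apply poly_one_minus_pow; auto.
- assert (Q : forall i s, (i <= n)%nat -> (s1 <= s <= s1 + d)%nat ->
    V (level_int (fun c => (1 - c) ^ i) s)).
  { intros i s Hi Hs.
    assert (Hsj : exists sg j, (sg <= 1 /\ s = s1 + sg + 2 * j)%nat).
    { destruct (Nat.Even_or_Odd (s - s1)) as [[j E]|[j E]];
        [exists 0%nat, j|exists 1%nat, j]; lia. }
    destruct Hsj as (sg & j & Hsg & ->).
    destruct (level_int_series (s1 + sg) i j) as (c & Hc & E).
    eapply HE; [intros h Hh; symmetry; apply E; auto|].
    apply subspace_scal; auto.
    apply (moments_in_basis (weight (s1 + sg + 1)) n (class_size d sg)
      (fun a => tame a /\ V (fun h => Rpower h (INR (s1 + sg + 1) / 2) * PSeries a h)));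
      auto using series_subspace.
    - intros r Hr; split; [apply class_seq_tame; auto|apply H; auto].
    - apply class_size_spec; auto; lia. }
  intros i s Hi Hs.
  apply (subspace_ext V HV (level_int (fun c => (1 - (1 - c)) ^ i) s)).
  + intros h; apply level_int_ext; intros c; unfold pow_fun; f_equal; ring.
  + apply (level_int_poly V (fun c => 1 - c) n) with (p := fun c => (1 - c) ^ i); auto.
    * intros c; apply (continuous_minus (V := R_NormedModule));
        [apply continuous_const|apply continuous_id].
    * apply poly_one_minus_pow; auto.
Qed.

Definition class_factor (n s1 d sg r : nat) : R -> R :=
  PSeries (PS_decr_n (class_seq n s1 d sg r) r).

Lemma class_fun_factor n s1 d sg r : (r < class_dim n (class_size d sg))%nat ->
  class_factor n s1 d sg r 0 <> 0 /\ smooth (- 2) 2 (class_factor n s1 d sg r) /\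
  forall h, 0 < h -> class_fun n s1 d sg r h =
    Rpower h (INR (s1 + sg + 1) / 2 + INR r) * class_factor n s1 d sg r h.
Proof.
intros Hr; unfold class_factor; set (a := class_seq n s1 d sg r); split; [|split].
- rewrite PSeries_0; unfold PS_decr_n; rewrite Nat.add_0_r.
  apply basis_seq_diag, weight_neq_0.
- intros k; apply Ck_PSeries, CV_radius_ge.
  destruct (class_seq_tame n s1 d sg r Hr) as [M HM].
  exists (/ 2 ^ r * M); intros m; unfold PS_decr_n.
  pose proof (pow_lt 2 r ltac:(lra)).
  replace (a (r + m)%nat * 2 ^ m) with (/ 2 ^ r * (a (r + m)%nat * 2 ^ (r + m)))
    by (rewrite pow_add; field; lra).
  rewrite Rabs_mult, Rabs_pos_eq by (left; apply Rinv_0_lt_compat; auto).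
  apply Rmult_le_compat_l; [left; apply Rinv_0_lt_compat; auto|apply HM].
- intros h Hh; unfold class_fun; fold a.
  rewrite (PSeries_decr_n_aux a r) by (intros; apply basis_seq_low; auto).
  rewrite Rpower_plus, Rpower_pow by auto; ring.
Qed.

Lemma sum_n_eq_0 (g : nat -> R) n : (forall i, (i <= n)%nat -> g i = 0) -> sum_n g n = 0.
Proof.
intros Hg; rewrite (sum_n_ext_loc g (fun _ => 0)) by auto.
rewrite sum_n_const; apply Rmult_0_r.
Qed.

Lemma sum_n_m_single (g : nat -> R) s s' k0 : (s <= k0 <= s')%nat ->
  (forall k, k <> k0 -> g k = 0) -> sum_n_m g s s' = g k0.
Proof.
intros Hk Hg; induction s' as [|s' IH].
- replace s with O by lia; replace k0 with O by lia; apply sum_n_n.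
- destruct (Nat.eq_dec s (S s')) as [E|].
  + subst; replace k0 with (S s') by lia; apply sum_n_n.
  + rewrite sum_n_Sm by lia; unfold plus; simpl.
    destruct (Nat.eq_dec k0 (S s')) as [->|].
    * rewrite (sum_n_m_ext_loc _ (fun _ => zero)) by (intros; apply Hg; lia).
      rewrite sum_n_m_const_zero; apply Rplus_0_l.
    * rewrite IH, (Hg (S s')) by lia; apply Rplus_0_r.
Qed.

Lemma subspace_sum_n_m {X} (V : (X -> R) -> Prop) (F : nat -> X -> R) s s' : subspace V ->
  (forall k, (s <= k <= s')%nat -> V (F k)) -> V (fun x => sum_n_m (fun k => F k x) s s').
Proof.
intros HV; destruct (le_lt_dec s s') as [Hs|Hs]; intros H.
- induction s' as [|s' IH].
  + replace s with O by lia; apply (subspace_ext V HV (F O)); [|apply H; lia].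
    intros; now rewrite sum_n_n.
  + destruct (Nat.eq_dec s (S s')) as [E|].
    * rewrite E; apply (subspace_ext V HV (F (S s'))); [|apply H; lia].
      intros; now rewrite sum_n_n.
    * apply (subspace_ext V HV (fun x => sum_n_m (fun k => F k x) s s' + 1 * F (S s') x)).
      -- intros x; rewrite sum_n_Sm, Rmult_1_l by lia; reflexivity.
      -- apply (subspace_lin V HV); [apply IH; [lia|intros; apply H; lia]|apply H; lia].
- apply (subspace_ext V HV (fun _ => 0)); [|apply (subspace_0 V HV)].
  intros x; rewrite sum_n_m_zero; auto.
Qed.

Definition melnikov_space (n s1 s2 s3 : nat) (f : R -> R) : Prop :=
  exists ap bp am bm, forall h, 0 < h < 2 ->
    f h = melnikov (pert n s1 s2 ap bp) (pert n s1 s3 am bm) h.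

Lemma level_comb_lin n e a a' c s s' h :
  level_comb n e (fun k i => a k i + c * a' k i) s s' h =
  level_comb n e a s s' h + c * level_comb n e a' s s' h.
Proof.
unfold level_comb.
rewrite <- (sum_n_m_mult_l (K := R_Ring)), <- (sum_n_m_plus (G := R_AbelianMonoid)).
apply sum_n_m_ext; intros k.
assert (E : sum_n (fun i => (a k i + c * a' k i) * level_int (pow_fun i) k h) n =
  sum_n (fun i => a k i * level_int (pow_fun i) k h) n +
  c * sum_n (fun i => a' k i * level_int (pow_fun i) k h) n).
{ rewrite <- (sum_n_mult_l (K := R_Ring)), <- (sum_n_plus (G := R_AbelianMonoid)).
  apply sum_n_ext; intros i; unfold plus, mult; simpl; real_eq; ring. }
rewrite E; unfold plus, mult; simpl; ring.
Qed.

Lemma level_comb_0 n e s s' h : level_comb n e (fun _ _ => 0) s s' h = 0.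
Proof.
pose proof (level_comb_lin n e (fun _ _ => 0) (fun _ _ => 0) (-1) s s' h) as E.
transitivity (level_comb n e (fun _ _ => 0) s s' h + -1 * level_comb n e (fun _ _ => 0) s s' h);
  [|ring].
rewrite <- E; apply sum_n_m_ext; intros k; f_equal; apply sum_n_ext; intros i.
real_eq; ring.
Qed.

Lemma level_comb_single n e v s0 i0 s s' h : (s <= s0 <= s')%nat -> (i0 <= n)%nat ->
  level_comb n e (fun k i => if Nat.eqb k s0 then if Nat.eqb i i0 then v else 0 else 0) s s' h =
  e s0 * (v * level_int (pow_fun i0) s0 h).
Proof.
intros Hs Hi; unfold level_comb; rewrite (sum_n_m_single _ s s' s0 Hs).
- rewrite Nat.eqb_refl; f_equal; unfold sum_n; rewrite (sum_n_m_single _ 0 n i0); [|lia|].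
  + now rewrite Nat.eqb_refl.
  + intros i Ni; destruct (Nat.eqb_spec i i0); [tauto|apply Rmult_0_l].
- intros k Nk; destruct (Nat.eqb_spec k s0); [tauto|].
  rewrite sum_n_eq_0 by (intros; apply Rmult_0_l); apply Rmult_0_r.
Qed.

Lemma melnikov_function_space n s1 s2 s3 : function_space (melnikov_space n s1 s2 s3).
Proof.
apply function_space_intro.
- exists (fun _ _ => 0), (fun _ _ => 0), (fun _ _ => 0), (fun _ _ => 0); intros h _.
  rewrite melnikov_expansion, !level_comb_0; ring.
- intros f g c (ap & bp & am & bm & Ef) (ap' & bp' & am' & bm' & Eg).
  exists (fun k i => ap k i + c * ap' k i), bp, (fun k i => am k i + c * am' k i), bm.
  intros h Hh; rewrite Ef, Eg, !melnikov_expansion, !level_comb_lin by auto; ring.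
- intros f g E (ap & bp & am & bm & Ef); exists ap, bp, am, bm.
  intros h Hh; rewrite <- E; auto.
Qed.

(** One nonzero coefficient is enough, in Q+ if s <= s2 and in Q- otherwise. *)
Lemma level_int_in_melnikov_space n s1 s2 s3 i s : (i <= n)%nat ->
  (s1 <= s <= Nat.max s2 s3)%nat -> melnikov_space n s1 s2 s3 (level_int (pow_fun i) s).
Proof.
intros Hi Hs.
set (del := fun (v : R) (k l : nat) => if Nat.eqb k s then if Nat.eqb l i then v else 0 else 0).
destruct (le_lt_dec s s2) as [H2|H2].
- exists (del 1), (fun _ _ => 0), (fun _ _ => 0), (fun _ _ => 0); intros h _.
  rewrite melnikov_expansion, level_comb_0; unfold del; rewrite level_comb_single by lia; ring.
- exists (fun _ _ => 0), (fun _ _ => 0), (del (- (-1) ^ s)), (fun _ _ => 0); intros h _.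
  rewrite melnikov_expansion, level_comb_0; unfold del; rewrite level_comb_single by lia.
  transitivity ((-1 * -1) ^ s * level_int (pow_fun i) s h).
  + replace (-1 * -1) with 1 by ring; rewrite pow1; ring.
  + rewrite Rpow_mult_distr; ring.
Qed.

Lemma level_comb_in_space (V : (R -> R) -> Prop) n e a s s' : subspace V ->
  (forall i k, (i <= n)%nat -> (s <= k <= s')%nat -> V (level_int (pow_fun i) k)) ->
  V (level_comb n e a s s').
Proof.
intros HV H.
apply (subspace_sum_n_m V
  (fun k h => e k * sum_n (fun i => a k i * level_int (pow_fun i) k h) n)); auto.
intros k Hk; apply subspace_scal; auto.
apply (subspace_sum V (a k) (fun i => level_int (pow_fun i) k)); auto.
Qed.

Theorem theorem1p2 (n s1 s2 s3 : nat)
  (hs1 : (1 <= s1)%nat) (hs2 : (1 <= s2)%nat) (hs3 : (1 <= s3)%nat)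
  (h12 : (s1 <= s2)%nat) (h13 : (s1 <= s3)%nat) :
  let shat := Nat.max s2 s3 in
  let bound : nat :=
    if Nat.eqb n 0 then (shat - s1)%nat
    else if Nat.eqb shat s1 then n
    else (2 * (n + shat - s1) - 1)%nat in
  let M := fun ap bp am bm : nat -> nat -> R =>
    melnikov (pert n s1 s2 ap bp) (pert n s1 s3 am bm) in
  exists eps0 : R, 0 < eps0 < 1 /\
    (forall ap bp am bm : nat -> nat -> R,
       nonzero_on (M ap bp am bm) 0 2 ->
       exists N : nat, zero_count (M ap bp am bm) 0 eps0 N /\ (N <= bound)%nat) /\
    (forall eps : R, 0 < eps <= eps0 ->
       exists ap bp am bm : nat -> nat -> R,
         nonzero_on (M ap bp am bm) 0 2 /\
         zero_count (M ap bp am bm) 0 eps bound).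
Proof.
intros shat bound M.
set (d := (shat - s1)%nat).
set (D := fun sg => class_dim n (class_size d sg)).
assert (HD : S bound = (D 0 + D 1)%nat).
{ unfold D; rewrite class_dim_total; unfold bound; f_equal.
  destruct (Nat.eqb_spec n 0); auto.
  destruct (Nat.eqb_spec shat s1); destruct (Nat.eqb_spec d 0); unfold d, shat in *; lia. }
(* the first D 0 indices enumerate the class of s1, the others that of s1 + 1 *)
set (cls := fun i => if lt_dec i (D 0%nat) then 0%nat else 1%nat).
set (idx := fun i => if lt_dec i (D 0%nat) then i else (i - D 0)%nat).
assert (Hcls : forall i, (i <= bound)%nat -> (cls i <= 1)%nat /\ (idx i < D (cls i))%nat).
{ intros i Hi; unfold cls, idx; destruct (lt_dec i (D 0%nat)); split; auto; lia. }
set (G := fun i => class_factor n s1 d (cls i) (idx i)).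
assert (HG : forall i, (i <= bound)%nat -> G i 0 <> 0 /\ smooth (- 2) 2 (G i) /\
  forall h, 0 < h -> class_fun n s1 d (cls i) (idx i) h =
    Rpower h (INR (s1 + cls i + 1) / 2 + INR (idx i)) * G i h).
{ intros i Hi; apply (class_fun_factor n s1 d (cls i) (idx i)), (proj2 (Hcls i Hi)). }
set (mu := fun i => INR (s1 + cls i + 1) / 2 + INR (idx i)).
destruct (power_system_zeros bound mu G 2) as (eps0 & Heps0 & Upper & Sharp); [lra| | |].
(* exponents of different classes differ by half an odd integer *)
{ intros i j Hij E; unfold mu, cls, idx in E; rewrite !plus_INR in E.
  destruct (lt_dec i (D 0%nat)); destruct (lt_dec j (D 0%nat)); simpl in E.
  - assert (E' : INR i = INR j) by lra; apply INR_eq in E'; lia.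
  - apply (INR_neq_half i (j - D 0%nat)); unfold half; lra.
  - lia.
  - assert (E' : INR (i - D 0%nat) = INR (j - D 0%nat)) by lra; apply INR_eq in E'; lia. }
{ intros i Hi; destruct (HG i Hi) as (G0 & GS & _); auto. }
set (F := fun (c : nat -> R) h => sum_n (fun i => c i * (Rpower h (mu i) * G i h)) bound) in *.
assert (EF : forall c h, 0 < h ->
  F c h = sum_n (fun i => c i * class_fun n s1 d (cls i) (idx i) h) bound).
{ intros c h Hh; apply sum_n_ext_loc; intros i Hi; f_equal.
  symmetry; apply (HG i Hi); auto. }
assert (Hd : (s1 + d = shat)%nat) by (unfold d, shat; lia).
assert (InF : forall ap bp am bm, exists c, forall h, 0 < h < 2 -> M ap bp am bm h = F c h).
{ set (T := fun f : R -> R => exists c, forall h, 0 < h < 2 -> f h = F c h).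
  assert (HT : function_space T).
  { apply function_space_intro.
    - exists (fun _ => 0); intros h Hh; symmetry; apply sum_n_eq_0; intros; apply Rmult_0_l.
    - intros f g c [cf Ef] [cg Eg]; exists (fun i => cf i + c * cg i); intros h Hh.
      rewrite Ef, Eg by auto; unfold F.
      rewrite <- (sum_n_mult_l (K := R_Ring)), <- (sum_n_plus (G := R_AbelianMonoid)).
      apply sum_n_ext; intros i; unfold plus, mult; simpl; real_eq; ring.
    - intros f g E [c Ef]; exists c; intros h Hh; rewrite <- E; auto. }
  pose proof HT as [HTS _].
  assert (L : forall i s, (i <= n)%nat -> (s1 <= s <= s1 + d)%nat -> T (level_int (pow_fun i) s)).
  { apply level_span; auto; intros sg r Hsg Hr.
    assert (Hi : exists i, (i <= bound)%nat /\ cls i = sg /\ idx i = r).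
    { fold (D sg) in Hr; destruct sg as [|[|sg]]; [exists r|exists (D 0 + r)%nat|lia];
        unfold cls, idx; split; try lia.
      - destruct (lt_dec r (D 0%nat)); lia.
      - destruct (lt_dec (D 0%nat + r) (D 0%nat)); lia. }
    destruct Hi as (i & Hi & <- & <-).
    exists (fun k => if Nat.eqb k i then 1 else 0); intros h Hh; rewrite EF by lra.
    unfold sum_n; rewrite (sum_n_m_single _ 0 bound i); [|lia|].
    - rewrite Nat.eqb_refl; ring.
    - intros k Hk; destruct (Nat.eqb_spec k i); [tauto|apply Rmult_0_l]. }
  intros ap bp am bm; change (T (M ap bp am bm)).
  apply (subspace_ext T HTS (fun h => level_comb n (fun _ => 1) ap s1 s2 h +
    1 * level_comb n (fun k => - (-1) ^ k) am s1 s3 h)).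
  - intros h; unfold M; rewrite melnikov_expansion, Rmult_1_l; auto.
  - apply (subspace_lin T HTS); apply level_comb_in_space; auto;
      intros i k Hi Hk; apply L; auto; unfold shat in Hd; lia. }
assert (InM : forall c, melnikov_space n s1 s2 s3 (F c)).
{ intros c; pose proof (melnikov_function_space n s1 s2 s3) as HMF; pose proof HMF as [HM HME].
  apply (HME (fun h => sum_n (fun i => c i * class_fun n s1 d (cls i) (idx i) h) bound)).
  - intros h Hh; symmetry; apply EF; lra.
  - apply (subspace_sum _ c (fun i => class_fun n s1 d (cls i) (idx i))); auto.
    intros i Hi; destruct (Hcls i Hi); apply level_span; auto.
    intros l s Hl Hs; apply level_int_in_melnikov_space; auto; fold shat; lia. }
exists eps0; split; auto; split.
- intros ap bp am bm (h & Hh & Nh).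
  destruct (InF ap bp am bm) as [c Ec].
  destruct (Upper c) as (N & C & HN).
  + apply NNPP; intros Nc; apply Nh; rewrite Ec by auto; unfold F.
    apply sum_n_eq_0; intros i Hi; replace (c i) with 0; [apply Rmult_0_l|].
    symmetry; apply NNPP; intros Ni; apply Nc; eauto.
  + exists N; split; auto; apply zero_count_ext with (F c); auto.
    intros x Hx; symmetry; apply Ec; lra.
- intros eps Heps; destruct (Sharp eps Heps) as (c & (h & Hh & Nh) & C).
  destruct (InM c) as (ap & bp & am & bm & E); exists ap, bp, am, bm; split.
  + exists h; split; [lra|]; unfold M; rewrite <- E by lra; auto.
  + apply zero_count_ext with (F c); auto; intros x Hx; apply E; lra.
Qed.
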